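(* The following hold. (1) For every $\sigma>0$ there exist $d_0(\sigma)\in\mathbb{N}$, $\eta_0(\sigma)>0$ and $\gamma(\sigma)>0$, with $\gamma$ monotonically decreasing in $\sigma$, such that for all $d\ge d_0(\sigma)$ and all $0<\eta<\eta_0(\sigma)$, $$n^\star(\eta,\sigma,\mathcal{F}_d)=\Omega\left(\frac{2^{\gamma(\sigma)d}}{\eta\, d}\right).$$ (2) For every $d\in\mathbb{N}$ there exist $\sigma_0(d)>0$ and $\eta_0(d)>0$ such that for all $0<\sigma<\sigma_0(d)$ and all $0<\eta<\eta_0(d)$, $$n^\star(\eta,\sigma,\mathcal{F}_d)=\Omega\left(\frac{2^{d}}{\eta\, d}\right).$$
   Context: $\mathcal{F}_d$ is the class of all probability distributions $P$ on $\mathbb{R}^d$ with $\mathrm{supp}(P)\subseteq[-1,1]^d$. $\mathcal{N}_\sigma=\mathcal{N}(0,\sigma^2\mathrm{I}_d)$, $\ast$ is convolution, and $h(\cdot)$ denotes differential entropy (natural logarithm). The minimax absolute-error risk is $$\mathcal{R}^\star(n,\sigma,\mathcal{F}_d)=\inf_{\hat h}\sup_{P\in\mathcal{F}_d}\mathbb{E}\big|h(P\ast\mathcal{N}_\sigma)-\hat h(S^n,\sigma)\big|,$$ where $S^n=(S_1,\dots,S_n)\sim P^{\otimes n}$ and the infimum is over all estimators $\hat h$ (measurable functions of the samples, with $\sigma$ known). The sample complexity is $n^\star(\eta,\sigma,\mathcal{F}_d)=\min\{n\in\mathbb{N}:\mathcal{R}^\star(n,\sigma,\mathcal{F}_d)\le\eta\}$.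 $a=\Omega(b)$ means $a\ge c\,b$ for a constant $c>0$; in (1) $c$ does not depend on $d$ or $\eta$, and in (2) $c$ does not depend on $d$, $\sigma$ or $\eta$. *)

(* Defs.v *)
From HB Require Import structures.
From mathcomp Require Import all_boot all_order all_algebra.
From mathcomp Require Import all_classical all_reals all_analysis.

Set Implicit Arguments.
Unset Strict Implicit.
Unset Printing Implicit Defensive.
Import Order.TTheory GRing.Theory Num.Theory.
Import numFieldNormedType.Exports.

Local Open Scope classical_set_scope.
Local Open Scope ring_scope.

Section product_cons.
Context (disp : measure_display) (T : measurableType disp) (R : realType).
Local Open Scope ereal_scope.

Definition cons_pair (n : nat) (p : T * n.-tuple T) : n.+1.-tuple T :=
  [tuple of p.1 :: p.2].

Lemma measurable_cons_pair n : measurable_fun [set: _] (@cons_pair n).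
Proof. exact: measurable_cons. Qed.

Variables (mu : {sigma_finite_measure set T -> \bar R}) (n : nat).
Variable nu : {sigma_finite_measure set (n.-tuple T) -> \bar R}.

Definition product_cons : set (n.+1.-tuple T) -> \bar R :=
  pushforward (mu \x nu) (@cons_pair n).

Let product_cons0 : product_cons set0 = 0.
Proof. by rewrite /product_cons /pushforward preimage_set0 measure0. Qed.

Let product_cons_ge0 A : 0 <= product_cons A.
Proof. exact: (measure_ge0 (mu \x nu)). Qed.

Let product_cons_sigma_additive : semi_sigma_additive product_cons.
Proof.
move=> F mF tF mUF; rewrite /product_cons /pushforward preimage_bigcup.
apply: (measure_semi_sigma_additive (s := (mu \x nu))).
- by move=> i; rewrite -[X in measurable X]setTI; exact: measurable_cons_pair.
- apply/trivIsetP => /= i j _ _ ij; rewrite -preimage_setI.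
  by move/trivIsetP : tF => /(_ _ _ _ _ ij) ->//; rewrite preimage_set0.
- rewrite -preimage_bigcup -[X in measurable X]setTI.
  exact: measurable_cons_pair.
Qed.

HB.instance Definition _ := isMeasure.Build _ _ _ product_cons
  product_cons0 product_cons_ge0 product_cons_sigma_additive.

Let uncons (t : n.+1.-tuple T) : T * n.-tuple T :=
  (thead t, [tuple of behead t]).

Let unconsK : cancel (@cons_pair n) uncons.
Proof.
by move=> [x t]; rewrite /uncons /cons_pair theadE; congr pair; apply/val_inj.
Qed.

Let measurable_uncons : measurable_fun [set: _] uncons.
Proof.
apply/measurable_fun_pairP; split => /=.
  exact: measurable_tnth.
exact: measurable_behead.
Qed.

Let product_cons_sigma_finite : sigma_finite [set: _] product_cons.
Proof.
have /sigma_finiteP[F [FT ndF Foo]] := sigma_finiteT mu.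
have /sigma_finiteP[G [GT ndG Goo]] := sigma_finiteT nu.
exists (fun i => uncons @^-1` (F i `*` G i)).
  rewrite -preimage_bigcup (_ : \bigcup_i _ = setT) ?preimage_setT//.
  rewrite -subTset => -[x t] _.
  have [i _ Fx] : (\bigcup_i F i) x by rewrite -FT.
  have [j _ Gt] : (\bigcup_j G j) t by rewrite -GT.
  exists (maxn i j) => //; split => /=.
    by move: x Fx; exact/subsetPset/ndF/leq_maxl.
  by move: t Gt; exact/subsetPset/ndG/leq_maxr.
move=> i; have [[mF Fi] [mG Gi]] := (Foo i, Goo i); split.
  rewrite -[X in measurable X]setTI; apply: measurable_uncons => //.
  exact: measurableX.
rewrite /product_cons /pushforward -comp_preimage.
rewrite (_ : uncons \o _ = id); last by apply/funext => p /=; rewrite unconsK.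
by rewrite preimage_id product_measure1E// lte_mul_pinfty// ge0_fin_numE.
Qed.

HB.instance Definition _ := Measure_isSigmaFinite.Build _ _ _ product_cons
  product_cons_sigma_finite.

End product_cons.

Section product_power.
Context (disp : measure_display) (T : measurableType disp) (R : realType).
Local Open Scope ereal_scope.

Fixpoint product_power (mu : {sigma_finite_measure set T -> \bar R}) (n : nat) :
    {sigma_finite_measure set (n.-tuple T) -> \bar R} :=
  match n with
  | 0 => \d_([tuple] : 0.-tuple T)
  | m.+1 => product_cons mu (product_power mu m)
  end.

Lemma product_powerE (mu : {sigma_finite_measure set T -> \bar R}) (n : nat)
    (A : 'I_n -> set T) : (forall i, measurable (A i)) ->
  product_power mu n [set t | forall i, A i (tnth t i)] =
  \prod_(i < n) mu (A i).
Proof.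
elim: n A => [|n IH] A mA.
  rewrite big_ord0 /= diracE (_ : _ \in _)//.
  by rewrite inE => -[].
rewrite big_ord_recl -IH// /= /product_cons /pushforward.
rewrite -product_measure1E//; last first.
  rewrite (_ : mkset _ = \bigcap_(i in [set: 'I_n])
      ((fun t => tnth t i) @^-1` A (lift ord0 i))); last first.
    by apply/seteqP; split => t /= At i => [_|]; exact: At.
  apply: fin_bigcap_measurable => // i _; rewrite -[X in measurable X]setTI.
  exact: measurable_tnth.
congr ((mu \x product_power mu n) _).
apply/seteqP; split => -[x t] /=.
  move=> H; split; first exact: H ord0.
  by move=> i; have := H (lift ord0 i); rewrite /cons_pair tnthS.
move=> [Ax At] i; case: (unliftP ord0 i) => [j ->|->]; last exact: Ax.
by rewrite /cons_pair tnthS; exact: At.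
Qed.

End product_power.

(* R^d with its Borel sigma-algebra, i.e. the product sigma-algebra. *)
Notation euclidean R d := (d.-tuple (measurableTypeR R)).

Section entropy_estimation.
Context (R : realType).
Local Open Scope ereal_scope.

Definition lebesgue_power (d : nat) :
    {sigma_finite_measure set (euclidean R d) -> \bar R} :=
  product_power (@lebesgue_measure R) d.

(* N(0, s^2 I_d); the second parameter of [normal_prob] is the standard
   deviation. *)
Definition gaussian (d : nat) (s : R) : set (euclidean R d) -> \bar R :=
  product_power (normal_prob 0%R s) d.

Section gaussian_probability.
Variables (d : nat) (s : R).

HB.instance Definition _ := SigmaFiniteMeasure.on (@gaussian d s).

Let gaussian_setT : @gaussian d s [set: euclidean R d] = 1.
Proof.
have := @product_powerE _ _ _ (normal_prob 0%R s) d (fun=> [set: _]).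
rewrite (_ : mkset _ = setT); last by apply/seteqP; split.
by move=> ->//; rewrite big1// => i _; exact: probability_setT.
Qed.

HB.instance Definition _ := @Measure_isProbability.Build _ _ _
  (@gaussian d s) gaussian_setT.

End gaussian_probability.

Section convolution.
Variable d : nat.

Definition tuple_add (p : euclidean R d * euclidean R d) : euclidean R d :=
  [tuple (tnth p.1 i + tnth p.2 i)%R | i < d].

Let measurable_tuple_add : measurable_fun [set: _] tuple_add.
Proof.
apply/measurable_fun_tnthP => i.
rewrite (_ : _ \o _ = fun p => (tnth p.1 i + tnth p.2 i)%R); last first.
  by apply/funext => p /=; rewrite tnth_mktuple.
apply: measurable_realfun.measurable_funD => /=;
  apply: (measurableT_comp (@measurable_tnth _ _ _ i)) => //.
Qed.

HB.instance Definition _ := @isMeasurableFun.Build _ _ _ _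
  tuple_add measurable_tuple_add.

Definition convolution (P Q : probability (euclidean R d) R) :
    probability (euclidean R d) R :=
  distribution (P \x Q) tuple_add.

(* The density is the Radon-Nikodym derivative with respect to Lebesgue
   measure, so this is meaningful only for [mu] absolutely continuous (as
   [convolution P (gaussian d s)] is for [0 < s]). The library sets [ln 0 = 0],
   hence [f * ln f] vanishes where [f] does. *)
Definition differential_entropy (mu : probability (euclidean R d) R) : \bar R :=
  let f := fun x =>
    fine (Radon_Nikodym (charge_of_finite_measure mu) (lebesgue_power d) x) in
  - \int[lebesgue_power d]_x (f x * ln (f x))%:E.

Definition support (P : probability (euclidean R d) R) : set (euclidean R d) :=
  [set x | forall e : R, (0 < e)%R ->
    0 < P [set y | forall i, (`|tnth y i - tnth x i| < e)%R]].

Definition cube : set (euclidean R d) :=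
  [set x | forall i, (-1 <= tnth x i <= 1)%R].

End convolution.

Definition supported_in_cube (d : nat) : set (probability (euclidean R d) R) :=
  [set P | support P `<=` @cube d].

(* The risk of the estimator [h] based on [n] samples; [s] is known, so an
   estimator is a measurable function of the samples chosen after [s]. *)
Definition absolute_risk (n d : nat) (s : R)
    (h : {mfun n.-tuple (euclidean R d) >-> R})
    (P : probability (euclidean R d) R) : \bar R :=
  \int[product_power P n]_x
    `|differential_entropy (convolution P (@gaussian d s)) - (h x)%:E|.

Definition minimax_risk (n d : nat) (s : R)
    (F : set (probability (euclidean R d) R)) : \bar R :=
  ereal_inf [set ereal_sup [set absolute_risk s h P | P in F]
            | h in [set: {mfun n.-tuple (euclidean R d) >-> R}]].

(* An infimum of a set of positive integers: the minimum if the set is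
   nonempty, +oo otherwise. *)
Definition sample_complexity (d : nat) (eta s : R)
    (F : set (probability (euclidean R d) R)) : \bar R :=
  ereal_inf [set n%:R%:E | n in
    [set n : nat | (0 < n)%N /\ minimax_risk n s F <= eta%:E]].

End entropy_estimation.

Arguments supported_in_cube : clear implicits.

(* Main.v *)
Require Import Defs.
From HB Require Import structures.
From mathcomp Require Import all_boot all_order all_algebra.
From mathcomp Require Import all_classical all_reals all_analysis.
From mathcomp Require Import measurable_realfun ring lra.
Import Order.TTheory GRing.Theory Num.Theory.
Import numFieldNormedType.Exports.

(** Both parts reduce to a statistical test between finitely supported laws on
    the vertices of the cube [-1,1]^d.  If one estimator has risk at most eta,
    then two laws that n samples cannot tell apart have smoothed entropies at
    distance O(eta) (Le Cam).  It remains to exhibit laws which are hard to tell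
    apart although their entropies differ.

    Entropies of smoothed mixtures.  Let P be the law giving mass p_i to x_i,
    so that P * N(0, s^2 I) has density f = sum_i p_i phi_i, where phi_i is the
    Gaussian density centred at x_i, and let h_N be the entropy of one Gaussian,
    which does not depend on its centre.  Three pointwise inequalities for
    t ln t are integrated:
    - h(f) <= h_N + H(p), where H(p) is the Shannon entropy of the weights
      (mixture_entropy_le);
    - h is concave in the mixture (mixture_entropy_concave);
    - h(f) >= h_N - 2 ln K as soon as the integral of sqrt (phi_i f) is at most
      K for every i (mixture_entropy_ge).  This is the comparison of relative
      entropy with the Renyi divergence of order 1/2; unlike a logarithm, a
      square root of a product factors over the coordinates.
    With J = info_gain s, an explicit decreasing function of s, the third one
    gives h >= h_N + d J for the uniform law on the 2^d vertices, and
    h >= h_N + J for the uniform law on two opposite vertices.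

    Small eta (two_point_bound).  Put masses p and 1 - p on two opposite
    vertices.  By the first inequality the entropy at p0 = (J/4)^2 is at most
    h_N + J/2, by the third one it is at least h_N + J at 1/2, so by concavity
    its slope to the right of p0 is at least J.  Moving p0 by e changes the
    entropy by at least e J, while e^2 n / p0 must be of order one for n samples
    to see the change.  Hence n >= c J^4 / eta^2.  This proves the second part:
    J is bounded below for s < 1, and 1 / eta >= 2^d / d for eta small.

    Large eta (birthday_bound).  Mix a fixed vertex, of mass 1 - e, with mass e
    spread either uniformly over all the vertices, or over a random codebook of
    k vertices drawn independently.  In the first case the entropy is at least
    h_N + e d J by concavity, in the second at most h_N + e (1 - ln e + ln k).
    With k about exp (d J / 4), the gap is of order e d J as long as
    - ln e <= d J / 4.  The codewords need not be separated by the noise: the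
    gap is linear in d, so a codebook exponentially smaller than the set of
    vertices already loses a fixed fraction of it.  Unless a codeword is
    drawn twice, the samples from a random codebook are distributed as fresh
    vertices; a repetition has probability at most (n e)^2 / k, hence
    n >= c sqrt k / e, and e is of order eta / (d J).

    In the first part, gamma = J / 8.  When - ln e > d J / 4 for this e, the
    accuracy eta is exponentially small in d, and the bound of order 1 / eta^2
    of the two-point test suffices. *)

Set Implicit Arguments.
Unset Strict Implicit.
Unset Printing Implicit Defensive.

Local Open Scope classical_set_scope.
Local Open Scope ring_scope.

(** * Iterated integrals over tuples *)

Section iterated_integrals.
Context (disp : measure_display) (T : measurableType disp) (R : realType).
Local Open Scope ereal_scope.

(** Every induction on the dimension, or on the number of samples, peels off the
    first component with this form of Tonelli's theorem. *)
Lemma ge0_integral_product_cons (n : nat)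
    (mu : {sigma_finite_measure set T -> \bar R})
    (nu : {sigma_finite_measure set (n.-tuple T) -> \bar R})
    (G : n.+1.-tuple T -> \bar R) :
  measurable_fun [set: n.+1.-tuple T] G -> (forall t, 0 <= G t) ->
  \int[product_cons mu nu]_t G t =
  \int[mu]_x \int[nu]_t G [tuple of x :: t].
Proof.
move=> mG G0; rewrite ge0_integral_pushforward//; last first.
  exact: measurable_cons_pair.
rewrite preimage_setT (fubini_tonelli1 (G \o @cons_pair _ _ n))//; last first.
  by move=> x; exact: G0.
by apply: measurableT_comp => //; exact: measurable_cons_pair.
Qed.

Lemma measurable_tuple_cons (n : nat) (x : T) :
  measurable_fun [set: n.-tuple T] (fun t => [tuple of x :: t] : n.+1.-tuple T).
Proof.
exact: (measurableT_comp (@measurable_cons_pair _ T n) (pair1_measurable x)).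
Qed.

Lemma measurable_integral_tuple_cons (n : nat)
    (nu : {sigma_finite_measure set (n.-tuple T) -> \bar R})
    (G : n.+1.-tuple T -> \bar R) :
  measurable_fun [set: n.+1.-tuple T] G -> (forall t, 0 <= G t) ->
  measurable_fun [set: T] (fun x => \int[nu]_t G [tuple of x :: t]).
Proof.
move=> mG G0.
apply: (measurable_fun_fubini_tonelli_F (m2 := nu) (G \o @cons_pair _ _ n)) => //=.
by apply: measurableT_comp => //; exact: measurable_cons_pair.
Qed.

Lemma measurable_prod_tnth (n : nat) (g : 'I_n -> T -> R) :
  (forall i, measurable_fun [set: T] (g i)) ->
  measurable_fun [set: n.-tuple T] (fun t => \prod_i g i (tnth t i))%R.
Proof.
move=> mg; apply: measurable_prod => i _.
by apply: (measurableT_comp (mg i)); exact: measurable_tnth.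
Qed.

(** Integrals of products of one-variable functions are the only integrals over
    R^d that have to be computed: the mass of a Gaussian density and the
    integrals of geometric means of densities. *)
Lemma ge0_integral_product_power (mu : {sigma_finite_measure set T -> \bar R})
    (n : nat) (g : 'I_n -> T -> R) :
  (forall i, measurable_fun [set: T] (g i)) -> (forall i x, (0 <= g i x)%R) ->
  \int[product_power mu n]_t (\prod_i g i (tnth t i))%:E =
  \prod_i \int[mu]_x (g i x)%:E.
Proof.
elim: n g => [|n IH] g mg g0.
  under eq_integral do rewrite big_ord0.
  by rewrite big_ord0 integral_cst//= diracT mule1.
have mprod : measurable_fun [set: n.-tuple T]
    (fun t => (\prod_(i < n) g (lift ord0 i) (tnth t i))%:E).
  apply/measurable_EFinP.
  exact: (measurable_prod_tnth (g := fun i => g (lift ord0 i))).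
have prod_ge0 (t : n.-tuple T) :
    0 <= (\prod_(i < n) g (lift ord0 i) (tnth t i))%:E.
  by rewrite lee_fin; exact: prodr_ge0.
rewrite /= ge0_integral_product_cons//; first last.
- by move=> t; rewrite lee_fin; exact: prodr_ge0.
- by apply/measurable_EFinP; exact: measurable_prod_tnth.
rewrite big_ord_recl -(IH (fun i => g (lift ord0 i)))//.
transitivity (\int[mu]_x ((g ord0 x)%:E * \int[product_power mu n]_t
    (\prod_(i < n) g (lift ord0 i) (tnth t i))%:E)).
  apply: eq_integral => x _; rewrite -ge0_integralZl//; last first.
    by rewrite lee_fin.
  apply: eq_integral => t _; rewrite -EFinM big_ord_recl tnth0.
  by under eq_bigr do rewrite tnthS.
rewrite ge0_integralZr//.
- exact/measurable_EFinP.
- by move=> x _; rewrite lee_fin.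
- exact: integral_ge0.
Qed.

End iterated_integrals.

(** * Densities and translations *)

Section densities.
Context (disp : measure_display) (T : measurableType disp) (R : realType).
Variables (nu : {finite_measure set T -> \bar R})
          (mu : {sigma_finite_measure set T -> \bar R}) (p : T -> R).
Local Open Scope ereal_scope.
Hypotheses (mp : measurable_fun [set: T] p)
  (nuE : forall A, measurable A -> nu A = \int[mu]_(x in A) (p x)%:E).

Lemma density_dominated : nu `<< mu.
Proof.
apply/null_content_dominatesP => A mA muA0; rewrite nuE// null_set_integral//.
by apply/measurable_EFinP; exact: measurable_funTS.
Qed.

(** The entropy of a measure may be computed from any of its densities, since they
    agree almost everywhere. *)
Lemma Radon_Nikodym_density :
  ae_eq mu [set: T] (Radon_Nikodym (charge_of_finite_measure nu) mu)
    (EFin \o p).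
Proof.
apply: integral_ae_eq => //.
- by apply: Radon_Nikodym_integrable; exact: density_dominated.
- exact/measurable_EFinP.
- move=> A _ mA; rewrite -Radon_Nikodym_integral//; last exact: density_dominated.
  exact: nuE.
Qed.

Lemma ge0_integral_density (G : T -> \bar R) :
  measurable_fun [set: T] G -> (forall x, 0 <= G x) ->
  \int[nu]_x G x = \int[mu]_x (G x * (p x)%:E).
Proof.
move=> mG G0.
have mf := measurable_int _ (Radon_Nikodym_SigmaFinite.f_integrable density_dominated).
rewrite -(Radon_Nikodym_SigmaFinite.change_of_variables density_dominated)//.
apply: ae_eq_integral => //.
- exact: emeasurable_funM.
- by apply: emeasurable_funM => //; exact/measurable_EFinP.
- apply: ae_eqe_mul2l; apply: integral_ae_eq => //.
  + exact/Radon_Nikodym_SigmaFinite.f_integrable/density_dominated.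
  + exact/measurable_EFinP.
  + move=> A _ mA; rewrite -Radon_Nikodym_SigmaFinite.f_integral//.
      exact: nuE.
    exact: density_dominated.
Qed.

End densities.

Section lebesgue_translation.
Context (R : realType).
Local Open Scope ereal_scope.
Implicit Types (G : measurableTypeR R -> \bar R).

Definition translate (a : R) (x : measurableTypeR R) : measurableTypeR R :=
  (a + x)%R.

Lemma measurable_translate (a : R) :
  measurable_fun [set: measurableTypeR R] (translate a).
Proof. exact: (@measurable_funD _ (measurableTypeR R) R). Qed.

(** Lebesgue measure is determined by its values on intervals, whose length a
    translation preserves. *)
Lemma ge0_integral_lebesgue_translate (a : R) G :
  measurable_fun [set: measurableTypeR R] G -> (forall x, 0 <= G x) ->
  \int[lebesgue_measure]_x G (a + x)%R = \int[lebesgue_measure]_x G x.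
Proof.
move=> mG G0.
have mD := measurable_translate a.
transitivity (\int[pushforward lebesgue_measure (translate a)]_x G x).
  by rewrite ge0_integral_pushforward// => y _; exact: G0.
  pose f := HB.pack_for {mfun (measurableTypeR R) >-> (measurableTypeR R)}
    (translate a) (isMeasurableFun.Build _ _ _ _ _ mD).
  apply: (eq_measure_integral lebesgue_measure
    (m1 := pushforward lebesgue_measure f)) => A mA _; apply/esym.
  apply: (lebesgue_measure_unique (mu := pushforward lebesgue_measure _)) => //.
  move=> X /ocitvP[->|[[u v] /= uv ->]]; first by rewrite !measure0.
  rewrite /pushforward.
  rewrite (_ : _ @^-1` _ = `](u - a)%R, (v - a)%R]%classic); last first.
    apply/seteqP; split => x; rewrite /translate/= !in_itv/= => /andP[? ?].
      by apply/andP; split; lra.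
    by apply/andP; split; lra.
  rewrite !lebesgue_measure_itv/= !lte_fin uv ltrD2r uv.
  by rewrite -!EFinD; congr EFin; lra.
Qed.

Lemma normal_pdf_translate (s m x : R) : s != 0%R ->
  normal_pdf m s (m + x)%R = normal_pdf 0 s x.
Proof.
by move=> s0; rewrite !normal_pdfE// /normal_fun addrAC subrr add0r subr0.
Qed.

Lemma ge0_integral_normal_translate (s a : R) G : s != 0%R ->
  measurable_fun [set: measurableTypeR R] G -> (forall x, 0 <= G x) ->
  \int[normal_prob 0%R s]_x G (a + x)%R =
  \int[lebesgue_measure]_x (G x * (normal_pdf a s x)%:E).
Proof.
move=> s0 mG G0.
have mD := measurable_translate a.
rewrite -[RHS](ge0_integral_lebesgue_translate a); first last.
- by move=> x; rewrite mule_ge0// lee_fin normal_pdf_ge0.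
- apply: emeasurable_funM => //; apply/measurable_EFinP.
  exact: measurable_normal_pdf.
have mpdf : measurable_fun [set: measurableTypeR R] (normal_pdf 0%R s).
  exact: measurable_normal_pdf.
have normalE A : measurable A -> normal_prob 0%R s A =
    \int[lebesgue_measure]_(x in A) (normal_pdf 0%R s x)%:E by [].
rewrite (ge0_integral_density mpdf normalE (measurableT_comp mG mD)); last first.
  by move=> x; exact: G0.
by apply: eq_integral => x _; rewrite normal_pdf_translate.
Qed.

End lebesgue_translation.

Section product_translation.
Context (R : realType).
Local Open Scope ereal_scope.

Lemma tuple_add_cons (d : nat) (x0 z0 : R) (x z : d.-tuple R) :
  tuple_add ([tuple of x0 :: x] : euclidean R d.+1,
             [tuple of z0 :: z] : euclidean R d.+1) =
  [tuple of (x0 + z0)%R :: tuple_add (x : euclidean R d, z : euclidean R d)].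
Proof.
apply: eq_from_tnth => i; rewrite tnth_mktuple /=.
by case: (unliftP ord0 i) => [j ->|->]; rewrite ?tnthS ?tnth0// tnth_mktuple.
Qed.

Lemma measurable_tuple_add (d : nat) (x : euclidean R d) :
  measurable_fun [set: euclidean R d] (fun z => tuple_add (x, z)).
Proof.
by apply: (measurableT_comp (measurable_funPT (@tuple_add R d))).
Qed.

(** One induction serves two purposes.  If m is a centred normal law and k a the
    normal density with mean a, this gives the density of the Gaussian law on
    R^d centred at x; if m is Lebesgue measure and k a = 1, it gives the
    translation invariance of Lebesgue measure on R^d. *)
Lemma ge0_integral_product_power_translate
    (m : {sigma_finite_measure set (measurableTypeR R) -> \bar R})
    (k : R -> measurableTypeR R -> R) :
  (forall a, measurable_fun [set: measurableTypeR R] (k a)) ->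
  (forall a y, (0 <= k a y)%R) ->
  (forall (a : R) (G : measurableTypeR R -> \bar R),
    measurable_fun [set: measurableTypeR R] G -> (forall y, 0 <= G y) ->
    \int[m]_z G (a + z)%R = \int[lebesgue_measure]_y (G y * (k a y)%:E)) ->
  forall (d : nat) (x : euclidean R d) (G : euclidean R d -> \bar R),
  measurable_fun [set: euclidean R d] G -> (forall y, 0 <= G y) ->
  \int[product_power m d]_z G (tuple_add (x, z)) =
  \int[lebesgue_power R d]_y
    (G y * (\prod_i k (tnth x i) (tnth y i))%:E).
Proof.
move=> mk k0 mE.
pose K d (x y : euclidean R d) : R := (\prod_i k (tnth x i) (tnth y i))%R.
suff main (d : nat) (x : euclidean R d) (G : euclidean R d -> \bar R) :
    measurable_fun [set: euclidean R d] G -> (forall y, 0 <= G y) ->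
    \int[product_power m d]_z G (tuple_add (x, z)) =
    \int[lebesgue_power R d]_y (G y * (K d x y)%:E) by exact: main.
have mK e (u : euclidean R e) : measurable_fun [set: euclidean R e] (K e u).
  exact: (measurable_prod_tnth (g := fun i => k (tnth u i))).
have K_ge0 e (u y : euclidean R e) : (0 <= K e u y)%R by exact: prodr_ge0.
have K0 (u y : euclidean R 0) : K 0%N u y = 1%R by rewrite /K big_ord0.
have KS e u0 (u : euclidean R e) y0 (y : euclidean R e) :
    K e.+1 [tuple of u0 :: u] [tuple of y0 :: y] = (k u0 y0 * K e u y)%R.
  rewrite /K big_ord_recl !tnth0; congr *%R.
  by apply: eq_bigr => i _; rewrite !tnthS.
(* Only the recursion KS matters for K; hiding its body keeps conversion
   from unfolding products of tuples. *)
clearbody K; rewrite /lebesgue_power.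
elim: d x G => [|d IH] x G mG G0.
  rewrite /= !integral_dirac//=.
  - rewrite !diracT !mul1e K0 mule1.
    by congr G; rewrite [LHS]tuple0 [RHS]tuple0.
  - by apply: emeasurable_funM => //; apply/measurable_EFinP; exact: mK.
  - by apply: (measurableT_comp mG); exact: measurable_tuple_add.
case/tupleP: x => x0 x.
pose GK (t : euclidean R d.+1) := G t * (K d.+1 [tuple of x0 :: x] t)%:E.
have mGK : measurable_fun [set: euclidean R d.+1] GK.
  by apply: emeasurable_funM => //; apply/measurable_EFinP; exact: mK.
have GK0 t : 0 <= GK t by rewrite mule_ge0// lee_fin K_ge0.
rewrite [LHS]ge0_integral_product_cons//; last first.
  by apply: (measurableT_comp mG); exact: measurable_tuple_add.
rewrite -[RHS]/(\int[product_cons lebesgue_measure (product_power lebesgue_measure d)]_y GK y).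
rewrite ge0_integral_product_cons//.
pose H y0 := \int[product_power lebesgue_measure d]_y
   (G [tuple of y0 :: y] * (K d x y)%:E).
have mGcons y0 : measurable_fun [set: euclidean R d]
    (fun y => G [tuple of y0 :: y]).
  by apply: (measurableT_comp mG); exact: measurable_tuple_cons.
transitivity (\int[m]_z0 H (x0 + z0)%R).
  apply: eq_integral => z0 _.
  rewrite /H -(IH x (fun y => G [tuple of (x0 + z0)%R :: y]))//.
  by apply: eq_integral => z _; rewrite tuple_add_cons.
rewrite (mE x0 H); first last.
- by move=> y0; apply: integral_ge0 => y _; rewrite mule_ge0// lee_fin K_ge0.
- pose G' (t : euclidean R d.+1) : \bar R :=
    G t * (K d x [tuple of behead t])%:E.
  have -> : H = fun y0 =>
      \int[product_power lebesgue_measure d]_y G' [tuple of y0 :: y].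
    apply/funext => y0; apply: eq_integral => y _; rewrite /G'.
    by congr (_ * (K d x _)%:E); exact: val_inj.
  apply: measurable_integral_tuple_cons.
    apply: emeasurable_funM => //; apply/measurable_EFinP.
    by apply: (measurableT_comp (mK d x)); exact: measurable_behead.
  by move=> t; rewrite mule_ge0// lee_fin K_ge0.
apply: eq_integral => y0 _; rewrite /H muleC -ge0_integralZl//; first last.
- by rewrite lee_fin.
- by move=> y _; rewrite mule_ge0// lee_fin K_ge0.
- by apply: emeasurable_funM => //; apply/measurable_EFinP; exact: mK.
by apply: eq_integral => y _; rewrite /GK KS EFinM muleCA.
Qed.

Lemma integral_lebesgue_power_translate (d : nat) (x : euclidean R d)
    (G : euclidean R d -> \bar R) :
  measurable_fun [set: euclidean R d] G ->
  \int[lebesgue_power R d]_z G (tuple_add (x, z)) =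
  \int[lebesgue_power R d]_y G y.
Proof.
have ge0 (H : euclidean R d -> \bar R) :
    measurable_fun [set: euclidean R d] H -> (forall y, 0 <= H y) ->
    \int[lebesgue_power R d]_z H (tuple_add (x, z)) =
    \int[lebesgue_power R d]_y H y.
  move=> mH H0; rewrite /lebesgue_power.
  rewrite (@ge0_integral_product_power_translate _ (fun _ _ => 1%R))//.
    by apply: eq_integral => y _; rewrite big1// mule1.
  move=> a K mK K0; rewrite ge0_integral_lebesgue_translate//.
  by apply: eq_integral => y _; rewrite mule1.
move=> mG; rewrite integralE [RHS]integralE; congr (_ - _).
- transitivity (\int[lebesgue_power R d]_z G^\+%E (tuple_add (x, z))).
    by apply: eq_integral => z _; rewrite unlock.
  by apply: ge0 => //; exact: measurable_funepos.
- transitivity (\int[lebesgue_power R d]_z G^\-%E (tuple_add (x, z))).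
    by apply: eq_integral => z _; rewrite unlock.
  by apply: ge0 => //; exact: measurable_funeneg.
Qed.

End product_translation.

Section gaussian_density.
Context (R : realType).
Local Open Scope ereal_scope.

Definition gaussian_pdf (d : nat) (s : R) (x y : d.-tuple R) : R :=
  (\prod_i normal_pdf (tnth x i) s (tnth y i))%R.

Lemma measurable_gaussian_pdf (d : nat) (s : R) (x : d.-tuple R) :
  measurable_fun [set: euclidean R d] (gaussian_pdf s x).
Proof.
apply: (measurable_prod_tnth (g := fun i => normal_pdf (tnth x i) s)) => i.
exact: measurable_normal_pdf.
Qed.

Lemma normal_pdf_gt0 (m s x : R) : s != 0%R -> (0 < normal_pdf m s x)%R.
Proof.
by move=> s0; rewrite normal_pdfE// mulr_gt0 ?normal_peak_gt0 ?expR_gt0.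
Qed.

Lemma gaussian_pdf_ge0 (d : nat) (s : R) (x y : d.-tuple R) :
  (0 <= gaussian_pdf s x y)%R.
Proof. by apply: prodr_ge0 => i _; exact: normal_pdf_ge0. Qed.

Lemma gaussian_pdf_gt0 (d : nat) (s : R) (x y : d.-tuple R) : s != 0%R ->
  (0 < gaussian_pdf s x y)%R.
Proof. by move=> s0; apply: prodr_gt0 => i _; exact: normal_pdf_gt0. Qed.

Lemma gaussian_pdf_le (d : nat) (s : R) (x y : d.-tuple R) : s != 0%R ->
  (gaussian_pdf s x y <= normal_peak s ^+ d)%R.
Proof.
move=> s0; rewrite -[X in (_ ^+ X)%R]card_ord -prodr_const.
by apply: ler_prod => i _; rewrite normal_pdf_ge0 normal_pdf_ub.
Qed.

Lemma integral_gaussian_pdf (d : nat) (s : R) (x : d.-tuple R) :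
  \int[lebesgue_power R d]_y (gaussian_pdf s x y)%:E = 1.
Proof.
pose g i : measurableTypeR R -> R := normal_pdf (tnth x i) s.
have mg i : measurable_fun [set: measurableTypeR R] (g i).
  exact: measurable_normal_pdf.
have g0 i y : (0 <= g i y)%R by exact: normal_pdf_ge0.
have := ge0_integral_product_power lebesgue_measure mg g0.
by rewrite big1// => i _; exact: integral_normal_pdf.
Qed.

Lemma ge0_integral_gaussian_translate (d : nat) (s : R) (x : euclidean R d)
    (G : euclidean R d -> \bar R) : s != 0%R ->
  measurable_fun [set: euclidean R d] G -> (forall y, 0 <= G y) ->
  \int[@gaussian R d s]_z G (tuple_add (x, z)) =
  \int[lebesgue_power R d]_y (G y * (gaussian_pdf s x y)%:E).
Proof.
move=> s0 mG G0; rewrite /gaussian /gaussian_pdf.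
rewrite (@ge0_integral_product_power_translate _ _ (normal_pdf ^~ s))//.
- by move=> a; exact: measurable_normal_pdf.
- by move=> a y; exact: normal_pdf_ge0.
- by move=> a K mK K0; rewrite (@ge0_integral_normal_translate _ s a K).
Qed.

(** Together with the translation invariance of Lebesgue measure, this makes the
    entropy of a Gaussian independent of its centre. *)
Lemma gaussian_pdf_translate (d : nat) (s : R) (x y : euclidean R d) :
  s != 0%R ->
  gaussian_pdf s x (tuple_add (x, y)) = gaussian_pdf s [tuple 0%R | _ < d] y.
Proof.
move=> s0; apply: eq_bigr => i _; rewrite !tnth_mktuple.
exact: normal_pdf_translate.
Qed.

End gaussian_density.

(** * Finite mixtures and their Gaussian smoothings *)

Section finite_mixtures.
Context (R : realType).

Record finite_law (I : finType) := FiniteLaw {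
  law_weight :> I -> R;
  law_ge0 : forall i, 0 <= law_weight i;
  law_sum1 : \sum_i law_weight i = 1 }.

Local Open Scope ereal_scope.
Context (disp : measure_display) (T : measurableType disp).

Section mixture.
Context (I : finType) (p : finite_law I) (x : I -> T).

(** Atom number k in the enumeration of I.  Indexing the atoms by nat presents a
    mixture as a finite sum of measures, which is a measure. *)
Definition mixture_component (k : nat) : {measure set T -> \bar R} :=
  if insub k is Some j then
    mscale (NngNum (law_ge0 p (enum_val (j : 'I_#|I|)))) \d_(x (enum_val j))
  else mzero.

Definition mixture : set T -> \bar R := msum mixture_component #|I|.

HB.instance Definition _ := Measure.on mixture.

Lemma ge0_integral_mixture (G : T -> \bar R) :
  measurable_fun [set: T] G -> (forall t, 0 <= G t) ->
  \int[mixture]_t G t = \sum_i (p i)%:E * G (x i).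
Proof.
move=> mG G0; rewrite /mixture ge0_integral_measure_sum//.
transitivity (\sum_(k < #|I|) (p (enum_val k))%:E * G (x (enum_val k))).
  apply: eq_bigr => k _; rewrite /mixture_component valK.
  by rewrite ge0_integral_mscale//= integral_dirac// diracT mul1e.
exact/esym/(big_enum_val (A := predT) (fun i => (p i)%:E * G (x i))).
Qed.

Lemma mixtureE (A : set T) : measurable A ->
  mixture A = \sum_i (p i)%:E * (\1_A (x i))%:E.
Proof.
move=> mA; rewrite -(ge0_integral_mixture (G := fun t => (\1_A t)%:E)).
- by rewrite integral_indic// setIT.
- by apply/measurable_EFinP; exact: measurable_indic.
- by move=> t; rewrite lee_fin.
Qed.

Lemma mixture_setT : mixture [set: T] = 1.
Proof.
rewrite mixtureE//; under eq_bigr do rewrite indicT mule1.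
by rewrite sumEFin law_sum1.
Qed.

HB.instance Definition _ := @Measure_isProbability.Build _ _ _ mixture mixture_setT.

End mixture.

Lemma big_ffun_recl (I : finType) (n : nat) (F : {ffun 'I_n.+1 -> I} -> \bar R) :
  \sum_j F j = \sum_i \sum_(j : {ffun 'I_n -> I})
    F [ffun k => if unlift ord0 k is Some k' then j k' else i].
Proof.
rewrite pair_bigA/=.
pose h (u : I * {ffun 'I_n -> I}) : {ffun 'I_n.+1 -> I} :=
  [ffun k => if unlift ord0 k is Some k' then u.2 k' else u.1].
rewrite (reindex h)//; exists (fun j : {ffun 'I_n.+1 -> I} =>
    (j ord0, [ffun k : 'I_n => j (lift ord0 k)])).
  move=> [i j] _; rewrite /h ffunE unlift_none/=; congr pair.
  by apply/ffunP => k; rewrite !ffunE liftK.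
move=> j _; apply/ffunP => k; rewrite ffunE/=.
by case: (unliftP ord0 k) => [k' ->|->]; rewrite ?ffunE.
Qed.

(** Expectations over n independent samples become finite sums over sequences of
    atoms, so that the testing arguments below are finite combinatorics. *)
Lemma ge0_integral_product_power_mixture (I : finType) (p : finite_law I)
    (x : I -> T) (n : nat) (G : n.-tuple T -> \bar R) :
  measurable_fun [set: n.-tuple T] G -> (forall t, 0 <= G t) ->
  \int[product_power (mixture p x) n]_t G t =
  \sum_(j : {ffun 'I_n -> I}) (\prod_l p (j l))%:E * G [tuple x (j l) | l < n].
Proof.
elim: n G => [|n IH] G mG G0.
  rewrite /= integral_dirac// diracT mul1e.
  rewrite (big_pred1 [ffun l => False_rect I (notF (valP l))]); last first.
    by move=> j /=; apply/esym/eqP/ffunP => -[].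
  by rewrite big_ord0 mul1e; congr G; rewrite [LHS]tuple0 [RHS]tuple0.
have mGcons y : measurable_fun [set: n.-tuple T] (fun t => G [tuple of y :: t]).
  by apply: (measurableT_comp mG); exact: measurable_tuple_cons.
rewrite [LHS]ge0_integral_product_cons// ge0_integral_mixture//; last 2 first.
- exact: measurable_integral_tuple_cons.
- by move=> y; exact: integral_ge0.
rewrite big_ffun_recl; apply: eq_bigr => i _; rewrite IH//.
rewrite ge0_sume_distrr; last first.
  move=> j _; rewrite mule_ge0// lee_fin prodr_ge0// => l _; exact: law_ge0.
apply: eq_bigr => j _; rewrite muleA -EFinM big_ord_recl ffunE unlift_none.
congr (_%:E * G _).
  by congr *%R; apply: eq_bigr => l _; rewrite ffunE liftK.
apply: eq_from_tnth => l; rewrite tnth_mktuple ffunE.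
by case: (unliftP ord0 l) => [l' ->|->]; rewrite ?tnthS ?tnth0// tnth_mktuple.
Qed.

End finite_mixtures.

Section mixture_in_cube.
Context (R : realType) (d : nat).

(** A box around y that has positive mass contains an atom, so y is as close as
    desired to points of the cube, coordinate by coordinate. *)
Lemma mixture_supported_in_cube (I : finType) (p : finite_law R I)
    (x : I -> euclidean R d) :
  (forall i, cube (x i)) -> supported_in_cube R d (mixture p x).
Proof.
move=> xcube y ysupp k; apply/andP.
have near (e : R) : 0 < e -> exists i, `|tnth (x i) k - tnth y k| < e.
  move=> e0; apply: contrapT => /forallNP no.
  have : (0 < mixture p x
      [set z : euclidean R d | forall l, (`|tnth z l - tnth y l| < e)%R])%E.
    exact: ysupp.
  rewrite mixtureE; last first.
    rewrite (_ : mkset _ = \bigcap_(l in [set: 'I_d])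
        ((fun z : euclidean R d => tnth z l) @^-1` [set r | `|r - tnth y l| < e])); last first.
      by apply/seteqP; split => z /= zy l => [_|]; exact: zy.
    apply: fin_bigcap_measurable => // l _; rewrite -[X in measurable X]setTI.
    apply: measurable_tnth => //.
    rewrite (_ : mkset _ = ball (tnth y l) e); last first.
      by apply/seteqP; split => r; rewrite /ball/= distrC.
    exact: measurable_ball.
  rewrite big1 ?ltxx// => i _; rewrite indicE memNset ?mule0//= => /(_ k).
  exact: no.
split; apply/ler_addgt0Pl => e /near[i].
  by have /andP[? ?] := xcube i k; rewrite ltr_norml => /andP[? ?]; lra.
by have /andP[? ?] := xcube i k; rewrite ltr_norml => /andP[? ?]; lra.
Qed.

End mixture_in_cube.

Section mixture_density.
Context (R : realType) (d : nat) (s : R).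
Hypothesis s0 : s != 0.

Definition mixture_pdf (I : finType) (p : finite_law R I)
    (x : I -> euclidean R d) (y : euclidean R d) : R :=
  \sum_i p i * gaussian_pdf s (x i) y.

Context (I : finType) (p : finite_law R I) (x : I -> euclidean R d).

Lemma measurable_mixture_pdf :
  measurable_fun [set: euclidean R d] (mixture_pdf p x).
Proof.
apply: measurable_sum => i; apply: measurable_funM => //.
exact: measurable_gaussian_pdf.
Qed.

Local Open Scope ereal_scope.

Lemma convolution_mixture_gaussian (A : set (euclidean R d)) : measurable A ->
  convolution (mixture p x) (@gaussian R d s) A =
  \int[lebesgue_power R d]_(y in A) (mixture_pdf p x y)%:E.
Proof.
move=> mA.
have mG : measurable_fun [set: euclidean R d] (fun y => (\1_A y)%:E : \bar R).
  by apply/measurable_EFinP; exact: measurable_indic.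
have G0 (y : euclidean R d) : 0 <= (\1_A y)%:E :> \bar R by rewrite lee_fin.
transitivity (\int[convolution (mixture p x) (@gaussian R d s)]_y (\1_A y)%:E).
  by rewrite integral_indic// setIT.
rewrite /convolution ge0_integral_distribution//.
have mGadd : measurable_fun [set: euclidean R d * euclidean R d]
    (fun u => (\1_A (tuple_add u))%:E : \bar R).
  exact: (measurableT_comp mG (measurable_funPT (@tuple_add R d))).
have Gadd0 u : 0 <= (\1_A (tuple_add u))%:E :> \bar R by exact: G0.
rewrite (fubini_tonelli1 (fun u => (\1_A (tuple_add u))%:E))//.
rewrite ge0_integral_mixture; last 2 first.
- exact: (measurable_fun_fubini_tonelli_F (m2 := @gaussian R d s)
    (fun u => (\1_A (tuple_add u))%:E)).
- by move=> y; exact: integral_ge0.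
transitivity (\sum_i \int[lebesgue_power R d]_y
    ((p i)%:E * ((\1_A y)%:E * (gaussian_pdf s (x i) y)%:E))).
  apply: eq_bigr => i _; rewrite ge0_integralZl//; last 3 first.
  - apply: emeasurable_funM => //; apply/measurable_EFinP.
    exact: measurable_gaussian_pdf.
  - by move=> y _; rewrite mule_ge0// lee_fin gaussian_pdf_ge0.
  - by rewrite lee_fin law_ge0.
  by rewrite -ge0_integral_gaussian_translate.
rewrite -ge0_integral_sum//; last 2 first.
- move=> i; apply: emeasurable_funM => //; apply: emeasurable_funM => //.
  by apply/measurable_EFinP; exact: measurable_gaussian_pdf.
- by move=> i y _; rewrite !mule_ge0// lee_fin ?law_ge0 ?gaussian_pdf_ge0.
rewrite [RHS]integral_mkcond epatch_indic; apply: eq_integral => y _.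
rewrite /mixture_pdf -sumEFin ge0_sume_distrl.
  by apply: eq_bigr => i _; rewrite EFinM muleCA muleC.
by move=> i _; rewrite lee_fin mulr_ge0 ?law_ge0 ?gaussian_pdf_ge0.
Qed.

Lemma differential_entropy_mixture_gaussian :
  differential_entropy (convolution (mixture p x) (@gaussian R d s)) =
  - \int[lebesgue_power R d]_y (mixture_pdf p x y * ln (mixture_pdf p x y))%:E.
Proof.
have mf := measurable_mixture_pdf.
have RN := Radon_Nikodym_density mf convolution_mixture_gaussian.
have dom := density_dominated mf convolution_mixture_gaussian.
rewrite /differential_entropy; congr (- _); apply: ae_eq_integral => //.
- have mr : measurable_fun [set: euclidean R d] (fun y => fine (Radon_Nikodym
      (charge_of_finite_measure (convolution (mixture p x) (@gaussian R d s)))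
      (lebesgue_power R d) y)).
    apply: (measurableT_comp (fine_measurable measurableT)).
    by apply: measurable_int; exact: Radon_Nikodym_integrable.
  apply/measurable_EFinP; apply: measurable_funM => //.
  exact: measurableT_comp.
- apply/measurable_EFinP; apply: measurable_funM => //.
  exact: measurableT_comp.
- by apply: filterS RN => y /= yRN _; rewrite yRN.
Qed.

End mixture_density.

(** * Inequalities for t ln t *)

Section entropy_function.
Context (R : realType).
Implicit Types t a b K : R.

Lemma ln_le_subr1 t : 0 < t -> ln t <= t - 1.
Proof. by move=> t0; rewrite -{1}(subrK 1 t) addrC le_ln1Dx// ltrBrDr addrC subrr. Qed.

(** The graph of t ln t lies above its tangent at a. *)
Lemma mulr_ln_tangent t a : 0 <= t -> 0 < a -> t * ln a + t - a <= t * ln t.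
Proof.
rewrite le_eqVlt => /predU1P[<-|t0] a0; first by rewrite !mul0r addr0 sub0r oppr_le0 ltW.
have : ln (a / t) <= a / t - 1 by rewrite ln_le_subr1// divr_gt0.
rewrite ln_div ?posrE// -(ler_pM2l t0) !mulrBr mulrCA divff ?gt_eqF//; lra.
Qed.

Lemma mulr_ln_convex (c : R) a b : 0 <= c <= 1 -> 0 < a -> 0 < b ->
  ((1 - c) * a + c * b) * ln ((1 - c) * a + c * b) <=
  (1 - c) * (a * ln a) + c * (b * ln b).
Proof.
move=> /andP[c0 c1] a0 b0; set m := _ + _.
have m0 : 0 < m.
  have [cn0|cn0] := eqVneq c 0; first by rewrite /m cn0 subr0 mul1r mul0r addr0.
  apply: ltr_wpDl; first by rewrite mulr_ge0 ?subr_ge0// ltW.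
  by rewrite mulr_gt0// lt0r cn0.
have /(ler_wpM2l c0) := mulr_ln_tangent (ltW b0) m0.
have c1' : 0 <= 1 - c by rewrite subr_ge0.
have /(ler_wpM2l c1') := mulr_ln_tangent (ltW a0) m0.
rewrite /m; nra.
Qed.

(** ln is increasing and every a i is at most the sum.  Applied to p_i phi_i, it
    bounds the entropy of a mixture by what is known once the labels are
    revealed. *)
Lemma mulr_ln_superadditive (I : finType) (a : I -> R) :
  (forall i, 0 <= a i) ->
  \sum_i a i * ln (a i) <= (\sum_i a i) * ln (\sum_i a i).
Proof.
move=> a0; rewrite mulr_suml; apply: ler_sum => i _.
have := a0 i; rewrite le_eqVlt => /predU1P[<-|ai0]; first by rewrite !mul0r.
rewrite ler_pM2l// ler_ln ?posrE//.
- by rewrite (bigD1 i)//= lerDl sumr_ge0.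
- by rewrite (bigD1 i)//= ltr_pwDl// sumr_ge0.
Qed.

(** Here ln u <= u - 1 is used at u = t and at u = 1 / sqrt t.  For a Gaussian
    density t the right-hand side is integrable, because the square root of a
    Gaussian density is a multiple of a wider one. *)
Lemma norm_mulr_ln_le t K : 0 < t <= K ->
  `|t * ln t| <= 2 * Num.sqrt t + K * t.
Proof.
move=> /andP[t0 tK].
have r0 : 0 < Num.sqrt t by rewrite sqrtr_gt0.
have tE : t = Num.sqrt t ^+ 2 by rewrite sqr_sqrtr// ltW.
have ub : ln t <= t - 1 by exact: ln_le_subr1.
have lb : - ln t <= 2 * (Num.sqrt t)^-1.
  have : ln (Num.sqrt t)^-1 <= (Num.sqrt t)^-1 - 1 by rewrite ln_le_subr1// invr_gt0.
  have -> : ln t = 2 * ln (Num.sqrt t) by rewrite {1}tE lnXn// mulr_natl.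
  by rewrite lnV ?posrE//; lra.
have h : t * (Num.sqrt t)^-1 = Num.sqrt t by rewrite {1}tE expr2 mulfK ?gt_eqF.
rewrite ler_norml; apply/andP; split; last by nra.
have : t * (- ln t) <= t * (2 * (Num.sqrt t)^-1) by rewrite ler_pM2l.
by rewrite mulrCA h; nra.
Qed.

(** With z = sqrt (a b) / (K a), this is ln z <= z - 1.  It trades the logarithm
    for a square root, which factors over products, with equality when
    K = sqrt (b / a). *)
Lemma relative_entropy_sqrt_bound a b K : 0 < a -> 0 < b -> 0 < K ->
  2 * (1 - ln K) * a - 2 / K * Num.sqrt (a * b) <= a * ln a - a * ln b.
Proof.
move=> a0 b0 K0; set r := Num.sqrt _.
have r0 : 0 < r by rewrite sqrtr_gt0 mulr_gt0.
have lnr : 2 * ln r = ln a + ln b.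
  by rewrite mulr_natl -lnXn// sqr_sqrtr ?mulr_ge0 ?ltW// lnM.
have : ln (r / (K * a)) <= r / (K * a) - 1.
  by rewrite ln_le_subr1// divr_gt0// mulr_gt0.
rewrite ln_div ?posrE ?mulr_gt0// lnM ?posrE//.
rewrite -(ler_pM2l a0) !mulrBr (_ : a * (r / (K * a)) = r / K); last first.
  by field; rewrite !gt_eqF.
rewrite (_ : 2 / K * r = 2 * (r / K)); last by field; rewrite gt_eqF.
move: (r / K) => q; move: lnr; move: (ln r) (ln a) (ln b) (ln K) => x y z w.
nra.
Qed.

End entropy_function.

(** * Entropy of a smoothed mixture *)

Section real_integrability.
Context (disp : measure_display) (T : measurableType disp) (R : realType).
Variable mu : {measure set T -> \bar R}.
Implicit Types f g l u : T -> R.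
Local Notation L1 f := (mu.-integrable [set: T] (EFin \o f)).

Lemma integrable_measurable f : L1 f -> measurable_fun [set: T] f.
Proof. by move=> /(measurable_int mu)/measurable_EFinP. Qed.

Lemma ge0_integrable f (K : R) : measurable_fun [set: T] f ->
  (forall x, 0 <= f x) -> (\int[mu]_x (f x)%:E <= K%:E)%E -> L1 f.
Proof.
move=> mf f0 fK; apply/integrableP; split; first exact/measurable_EFinP.
under eq_integral do rewrite /= ger0_norm//.
by apply: le_lt_trans fK _; exact: ltry.
Qed.

Lemma integrableZ_EFin (k : R) f : L1 f -> L1 (fun x => k * f x).
Proof.
move=> fi; apply: eq_integrable (integrableZl measurableT k fi) => // x _.
Qed.

Lemma integrableD_EFin f g : L1 f -> L1 g -> L1 (fun x => f x + g x).
Proof.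
by move=> fi gi; apply: eq_integrable (integrableD measurableT fi gi).
Qed.

Lemma integrableB_EFin f g : L1 f -> L1 g -> L1 (fun x => f x - g x).
Proof.
by move=> fi gi; apply: eq_integrable (integrableB measurableT fi gi).
Qed.

Lemma integrable_sum_EFin (I : finType) (f : I -> T -> R) :
  (forall i, L1 (f i)) -> L1 (fun x => \sum_i f i x).
Proof.
move=> fi.
have := @integrable_sum _ _ _ mu _ measurableT I (index_enum I) xpredT
  (fun i => EFin \o f i) (fun i _ => fi i).
by apply: eq_integrable => // x _; rewrite /= sumEFin.
Qed.

(** Entropy integrands have no sign: they are controlled from both sides. *)
Lemma integrable_between l u f : measurable_fun [set: T] f ->
  (forall x, l x <= f x <= u x) -> L1 l -> L1 u -> L1 f.
Proof.
move=> mf lfu li ui; apply: (@le_integrable _ _ _ mu _ measurableT _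
    (EFin \o (fun x => `|l x| + `|u x|))).
- exact/measurable_EFinP.
- move=> x _ /=; rewrite lee_fin [leRHS]ger0_norm//.
  have /andP[lf fu] := lfu x; rewrite ler_norml.
  have := ler_norm (u x); have := ler_norm (- l x); rewrite normrN.
  have := normr_ge0 (u x); have := normr_ge0 (l x).
  by move=> ? ? ? ?; apply/andP; split; lra.
- by apply: integrableD_EFin; [exact: integrable_norm li|exact: integrable_norm ui].
Qed.

Lemma Rintegral_sum (I : finType) (f : I -> T -> R) :
  (forall i, L1 (f i)) ->
  \int[mu]_x (\sum_i f i x) = \sum_i \int[mu]_x f i x.
Proof.
move=> fi; rewrite /Rintegral.
under eq_integral do rewrite -sumEFin.
rewrite (integral_sum measurableT (f := fun i => EFin \o f i))//.
by rewrite sum_fine// => i _; exact: integrable_fin_num (fi i).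
Qed.

End real_integrability.

Section gaussian_integrability.
Context (R : realType).

Lemma sqrtr_prod (I : finType) (a : I -> R) : (forall i, 0 <= a i) ->
  Num.sqrt (\prod_i a i) = \prod_i Num.sqrt (a i).
Proof.
move=> a0; rewrite -[RHS]ger0_norm ?prodr_ge0// -sqrtr_sqr -prodrXl.
by congr Num.sqrt; apply: eq_bigr => i _; rewrite sqr_sqrtr.
Qed.

Variables (d : nat) (s : R).
Hypothesis s0 : s != 0.
Implicit Types x y : euclidean R d.
Local Notation mu := (lebesgue_power R d).
Local Notation L1 f := (mu.-integrable [set: euclidean R d] (EFin \o f)).

(** Taking the square root doubles the variance in the exponent. *)
Lemma sqrt_gaussian_pdf : exists K : R, forall x y,
  Num.sqrt (gaussian_pdf s x y) = K * gaussian_pdf (s * Num.sqrt 2) x y.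
Proof.
have s20 : s * Num.sqrt 2 != 0 by rewrite mulf_neq0// gt_eqF// sqrtr_gt0.
pose K := Num.sqrt (normal_peak s) / normal_peak (s * Num.sqrt 2).
exists (K ^+ d) => x y.
rewrite /gaussian_pdf sqrtr_prod => [|i]; last exact: normal_pdf_ge0.
rewrite -[X in K ^+ X]card_ord -prodr_const -big_split/=.
apply: eq_bigr => i _; rewrite !normal_pdfE// sqrtrM ?normal_peak_ge0//.
rewrite /K mulrA divfK ?gt_eqF ?normal_peak_gt0//; congr *%R.
rewrite /normal_fun exprMn sqr_sqrtr//.
move: (tnth y i - tnth x i) => z.
rewrite (_ : - z ^+ 2 / (s ^+ 2 *+ 2) = (- z ^+ 2 / (s ^+ 2 * 2 *+ 2)) *+ 2).
  by rewrite mulr2n expRD -expr2 sqrtr_sqr ger0_norm// expR_ge0.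
by field.
Qed.

Lemma integrable_gaussian_pdf x : L1 (gaussian_pdf s x).
Proof.
apply: (ge0_integrable (K := 1)).
- exact: measurable_gaussian_pdf.
- by move=> y; exact: gaussian_pdf_ge0.
- by rewrite integral_gaussian_pdf.
Qed.

Lemma Rintegral_gaussian_pdf x : \int[mu]_y gaussian_pdf s x y = 1.
Proof. by rewrite /Rintegral integral_gaussian_pdf. Qed.

End gaussian_integrability.

Section mixture_entropy.
Context (R : realType).
Variables (d : nat) (s : R).
Hypothesis s0 : s != 0.
Implicit Types x y : euclidean R d.
Local Notation mu := (lebesgue_power R d).
Local Notation L1 f := (mu.-integrable [set: euclidean R d] (EFin \o f)).

Lemma measurable_xlnx (f : euclidean R d -> R) :
  measurable_fun [set: euclidean R d] f ->
  measurable_fun [set: euclidean R d] (fun y => f y * ln (f y)).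
Proof.
by move=> mf; apply: measurable_funM => //; exact: measurableT_comp.
Qed.

Lemma integrable_gaussian_xlnx x :
  L1 (fun y => gaussian_pdf s x y * ln (gaussian_pdf s x y)).
Proof.
have [K sqrtE] := sqrt_gaussian_pdf d s0.
pose C := normal_peak s ^+ d.
pose u y := 2 * (K * gaussian_pdf (s * Num.sqrt 2) x y) + C * gaussian_pdf s x y.
have ui : L1 u.
  by apply: integrableD_EFin; do !apply: integrableZ_EFin; exact: integrable_gaussian_pdf.
apply: (integrable_between (l := fun y => -1 * u y) (u := u)) => //.
- by apply: measurable_xlnx; exact: measurable_gaussian_pdf.
- move=> y; rewrite mulN1r -ler_norml /u -sqrtE.
  by apply: norm_mulr_ln_le; rewrite gaussian_pdf_gt0// gaussian_pdf_le.
- exact: integrableZ_EFin.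
Qed.

Section fixed_mixture.
Context (I : finType) (p : finite_law R I) (x : I -> euclidean R d).
Local Notation f := (mixture_pdf s p x).

Lemma mixture_pdf_gt0 y : 0 < f y.
Proof.
have [//|fy] := ltP 0 (f y).
suff : \sum_i p i = 0 by rewrite law_sum1 => /eqP; rewrite oner_eq0.
apply: big1 => i _.
apply/eqP; rewrite eq_le law_ge0 andbT.
rewrite -(ler_pM2r (gaussian_pdf_gt0 (x i) y s0)) mul0r.
apply: le_trans fy; rewrite /mixture_pdf (bigD1 i)//= lerDl sumr_ge0// => j _.
by rewrite mulr_ge0 ?law_ge0 ?gaussian_pdf_ge0.
Qed.

Lemma mixture_pdf_le y : f y <= normal_peak s ^+ d.
Proof.
rewrite -[leRHS]mul1r -(law_sum1 p) mulr_suml; apply: ler_sum => i _.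
by rewrite ler_wpM2l ?law_ge0 ?gaussian_pdf_le.
Qed.

Lemma measurable_sqrt_gaussian_mixture (z : euclidean R d) :
  measurable_fun [set: euclidean R d]
    (fun y => Num.sqrt (gaussian_pdf s z y * f y)).
Proof.
apply: (measurableT_comp (continuous_measurable_fun (@sqrt_continuous R))).
apply: measurable_funM; first exact: measurable_gaussian_pdf.
exact: measurable_mixture_pdf.
Qed.

Lemma integrable_mixture_pdf : L1 f.
Proof.
apply: integrable_sum_EFin => i; apply: integrableZ_EFin.
exact: integrable_gaussian_pdf.
Qed.

Lemma Rintegral_mixture_pdf : \int[mu]_y f y = 1.
Proof.
rewrite Rintegral_sum => [|i].
  rewrite -(law_sum1 p); apply: eq_bigr => i _.
  by rewrite RintegralZl ?Rintegral_gaussian_pdf ?mulr1//; exact: integrable_gaussian_pdf.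
by apply: integrableZ_EFin; exact: integrable_gaussian_pdf.
Qed.

(** The left-hand side is the sum of (p i phi_i) ln (p i phi_i), expanded. *)
Lemma xlnx_mixture_ge y :
  \sum_i (p i * ln (p i) * gaussian_pdf s (x i) y +
    p i * (gaussian_pdf s (x i) y * ln (gaussian_pdf s (x i) y))) <=
  f y * ln (f y).
Proof.
apply: le_trans (mulr_ln_superadditive _) => [|i]; last first.
  by rewrite mulr_ge0 ?law_ge0 ?gaussian_pdf_ge0.
apply: ler_sum => i _; have := law_ge0 p i.
rewrite le_eqVlt => /predU1P[<-|pi0]; first by rewrite !mul0r addr0.
have g0 := gaussian_pdf_gt0 (x i) y s0.
by rewrite lnM ?posrE//; lra.
Qed.

Lemma integrable_xlnx_mixture : L1 (fun y => f y * ln (f y)).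
Proof.
pose l y := \sum_i (p i * ln (p i) * gaussian_pdf s (x i) y +
    p i * (gaussian_pdf s (x i) y * ln (gaussian_pdf s (x i) y))).
pose C := normal_peak s ^+ d.
apply: (integrable_between (l := l) (u := fun y => ln C * f y)).
- by apply: measurable_xlnx; exact: measurable_mixture_pdf.
- move=> y; rewrite xlnx_mixture_ge/= mulrC.
  rewrite ler_pM2r ?mixture_pdf_gt0// ler_ln ?posrE ?mixture_pdf_gt0 ?mixture_pdf_le//.
  by rewrite exprn_gt0// normal_peak_gt0.
- apply: integrable_sum_EFin => i; apply: integrableD_EFin; apply: integrableZ_EFin.
    exact: integrable_gaussian_pdf.
  exact: integrable_gaussian_xlnx.
- by apply: integrableZ_EFin; exact: integrable_mixture_pdf.
Qed.

Definition mixture_entropy : R := - \int[mu]_y (f y * ln (f y)).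

Lemma differential_entropy_mixtureE :
  differential_entropy (convolution (mixture p x) (@gaussian R d s)) =
  mixture_entropy%:E.
Proof.
rewrite differential_entropy_mixture_gaussian// /mixture_entropy EFinN fineK//.
exact: integrable_fin_num integrable_xlnx_mixture.
Qed.

End fixed_mixture.

Definition gaussian_entropy : R :=
  - \int[mu]_y (gaussian_pdf s [tuple 0 | _ < d] y *
                ln (gaussian_pdf s [tuple 0 | _ < d] y)).

Lemma Rintegral_gaussian_xlnx x :
  \int[mu]_y (gaussian_pdf s x y * ln (gaussian_pdf s x y)) =
  - gaussian_entropy.
Proof.
rewrite /gaussian_entropy opprK.
pose G y := (gaussian_pdf s x y * ln (gaussian_pdf s x y))%:E.
have mG : measurable_fun [set: euclidean R d] G.
  by apply/measurable_EFinP; exact: (measurable_xlnx (measurable_gaussian_pdf s x)).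
apply: (congr1 fine (x := \int[mu]_y G y)%E).
rewrite -(integral_lebesgue_power_translate x mG).
by apply: eq_integral => y _; rewrite /G gaussian_pdf_translate.
Qed.

(** Observing a sample gives less information than observing also which atom it
    comes from, and the label alone has entropy - sum_i p_i ln p_i. *)
Lemma mixture_entropy_le (I : finType) (p : finite_law R I)
    (x : I -> euclidean R d) :
  mixture_entropy p x <= gaussian_entropy - \sum_i p i * ln (p i).
Proof.
have gi i := integrable_gaussian_pdf s (x i).
have gxi i := integrable_gaussian_xlnx (x i).
suff : - gaussian_entropy + \sum_i p i * ln (p i) <= - mixture_entropy p x by lra.
rewrite /mixture_entropy [leRHS]opprK.
have li : L1 (fun y => \sum_i (p i * ln (p i) * gaussian_pdf s (x i) y +
    p i * (gaussian_pdf s (x i) y * ln (gaussian_pdf s (x i) y)))).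
  apply: integrable_sum_EFin => i; apply: integrableD_EFin; exact: integrableZ_EFin.
apply: le_trans _ (le_Rintegral measurableT li (integrable_xlnx_mixture p x)
  (fun y _ => xlnx_mixture_ge p x y)).
rewrite Rintegral_sum => [|i]; last first.
  by apply: integrableD_EFin; apply: integrableZ_EFin.
rewrite -[- gaussian_entropy]mul1r -(law_sum1 p) mulr_suml -big_split/=.
apply: ler_sum => i _; rewrite RintegralD//; [|exact: integrableZ_EFin..].
rewrite !RintegralZl// Rintegral_gaussian_pdf Rintegral_gaussian_xlnx; lra.
Qed.

(** The condition on the densities, rather than on weights and atoms, allows the
    three mixtures to have unrelated index types. *)
Lemma mixture_entropy_concave (c : R) (I0 I1 I : finType)
    (p0 : finite_law R I0) (x0 : I0 -> euclidean R d)
    (p1 : finite_law R I1) (x1 : I1 -> euclidean R d)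
    (p : finite_law R I) (x : I -> euclidean R d) :
  0 <= c <= 1 ->
  (forall y, mixture_pdf s p x y =
    (1 - c) * mixture_pdf s p0 x0 y + c * mixture_pdf s p1 x1 y) ->
  (1 - c) * mixture_entropy p0 x0 + c * mixture_entropy p1 x1 <=
  mixture_entropy p x.
Proof.
move=> c01 pE.
have i0 := integrable_xlnx_mixture p0 x0.
have i1 := integrable_xlnx_mixture p1 x1.
rewrite /mixture_entropy !mulrN -opprD lerN2.
rewrite -!RintegralZl// -RintegralD//; [|exact: integrableZ_EFin..].
apply: le_Rintegral => //.
- exact: integrable_xlnx_mixture.
- by apply: integrableD_EFin; exact: integrableZ_EFin.
- by move=> y _; rewrite pE; apply: mulr_ln_convex => //; exact: mixture_pdf_gt0.
Qed.

(** The excess of h(f) over the Gaussian entropy is the mutual information, that is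
    the p-average of the relative entropies of phi_i with respect to f.  Each of
    them is at least - 2 ln of the integral of sqrt (phi_i f). *)
Lemma mixture_entropy_ge (I : finType) (p : finite_law R I)
    (x : I -> euclidean R d) (K : R) : 0 < K ->
  (forall i, (\int[mu]_y
    (Num.sqrt (gaussian_pdf s (x i) y * mixture_pdf s p x y))%:E <= K%:E)%E) ->
  gaussian_entropy - 2 * ln K <= mixture_entropy p x.
Proof.
move=> K0 sqrtK; pose f := mixture_pdf s p x.
pose r i y := Num.sqrt (gaussian_pdf s (x i) y * f y).
have ri i : L1 (r i).
  apply: ge0_integrable (sqrtK i) => [|y]; last exact: sqrtr_ge0.
  exact: measurable_sqrt_gaussian_mixture.
have rK i : \int[mu]_y r i y <= K.
  rewrite -lee_fin fineK; first exact: sqrtK.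
  exact: integrable_fin_num (ri i).
have fi : L1 f by exact: integrable_mixture_pdf.
have gi i := integrable_gaussian_pdf s (x i).
have gxi i := integrable_gaussian_xlnx (x i).
have pt y : f y * ln (f y) <=
    \sum_i (p i * (gaussian_pdf s (x i) y * ln (gaussian_pdf s (x i) y)) +
      (p i * (2 / K) * r i y)) - 2 * (1 - ln K) * f y.
  suff : 0 <= \sum_i p i * (gaussian_pdf s (x i) y * ln (gaussian_pdf s (x i) y) -
     gaussian_pdf s (x i) y * ln (f y) - (2 * (1 - ln K) * gaussian_pdf s (x i) y -
       2 / K * r i y)).
    move=> h; rewrite -subr_ge0 (le_trans h)// le_eqVlt.
    apply/orP; left; apply/eqP.
    rewrite {2 3}/f /mixture_pdf mulr_sumr mulr_suml -!sumrB.
    by apply: eq_bigr => i _; lra.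
  apply: sumr_ge0 => i _; rewrite mulr_ge0 ?law_ge0// subr_ge0.
  apply: relative_entropy_sqrt_bound => //; first exact: gaussian_pdf_gt0.
  exact: mixture_pdf_gt0.
have ui i : L1 (fun y => p i * (gaussian_pdf s (x i) y * ln (gaussian_pdf s (x i) y)) +
      (p i * (2 / K) * r i y)).
  by apply: integrableD_EFin; exact: integrableZ_EFin.
suff : - mixture_entropy p x <= - gaussian_entropy + 2 * ln K by lra.
rewrite /mixture_entropy [leLHS]opprK.
have usum : L1 (fun y => \sum_i (p i * (gaussian_pdf s (x i) y *
    ln (gaussian_pdf s (x i) y)) + (p i * (2 / K) * r i y)) - 2 * (1 - ln K) * f y).
  by apply: integrableB_EFin; [exact: integrable_sum_EFin|exact: integrableZ_EFin].
have /le_trans := le_Rintegral measurableT (integrable_xlnx_mixture p x) usum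
  (fun y _ => pt y).
apply.
rewrite RintegralB//; [|exact: integrable_sum_EFin|exact: integrableZ_EFin].
rewrite RintegralZl// Rintegral_mixture_pdf Rintegral_sum//.
suff : \sum_i \int[mu]_y (p i * (gaussian_pdf s (x i) y * ln (gaussian_pdf s (x i) y)) +
      (p i * (2 / K) * r i y)) <= \sum_i p i * (2 - gaussian_entropy).
  rewrite -mulr_suml law_sum1 mul1r; lra.
apply: ler_sum => i _; rewrite RintegralD//; [|exact: integrableZ_EFin..].
rewrite !RintegralZl// Rintegral_gaussian_xlnx -mulrA -mulrDr ler_wpM2l ?law_ge0//.
suff : 2 / K * (\int[mu]_y r i y) <= 2 by lra.
by rewrite -mulrA ger_pMr// mulrC ler_pdivrMr// mul1r.
Qed.

End mixture_entropy.

(** * Information carried by the vertices of the cube *)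

Section sqrt_mean.
Context (R : realType).

(** The geometric mean of q and of (q + r) / 2 is compared with quantities whose
    integrals are known.  Both sides agree to first order at q = r, and the
    difference of their squares is (sqrt q - sqrt r)^2 times a positive form.
    The weight 2 / 40 of sqrt (q r), the only term whose integral is less than
    one, is what the bound gains. *)
Lemma sqrt_mean_le (q r : R) : 0 <= q -> 0 <= r ->
  Num.sqrt (q * ((q + r) / 2)) <=
  29 / 40 * q + 9 / 40 * r + 2 / 40 * Num.sqrt (q * r).
Proof.
move=> q0 r0; rewrite [Num.sqrt (q * r)]sqrtrM//.
have u0 := sqrtr_ge0 q; have v0 := sqrtr_ge0 r.
rewrite -[X in 29 / 40 * X](sqr_sqrtr q0) -[X in 9 / 40 * X](sqr_sqrtr r0).
rewrite (_ : q * ((q + r) / 2) =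
    Num.sqrt q ^+ 2 * ((Num.sqrt q ^+ 2 + Num.sqrt r ^+ 2) / 2)); last first.
  by rewrite !sqr_sqrtr.
move: (Num.sqrt q) (Num.sqrt r) u0 v0 => u v u0 v0.
have w0 : 0 <= 29 / 40 * u ^+ 2 + 9 / 40 * v ^+ 2 + 2 / 40 * (u * v).
  have uv0 := mulr_ge0 u0 v0; have u2 := sqr_ge0 u; have v2 := sqr_ge0 v; lra.
rewrite -(ler_sqr (sqrtr_ge0 _) w0) sqr_sqrtr; last first.
  by rewrite mulr_ge0 ?sqr_ge0// divr_ge0// addr_ge0// sqr_ge0.
rewrite -subr_ge0 (_ : _ - _ = (u - v) ^+ 2 *
  (41 * u ^+ 2 + 198 * (u * v) + 81 * v ^+ 2) / 1600); last by field.
have uv0 := mulr_ge0 u0 v0; have u2 := sqr_ge0 u; have v2 := sqr_ge0 v.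
have sum0 : 0 <= 41 * u ^+ 2 + 198 * (u * v) + 81 * v ^+ 2 by lra.
by apply: divr_ge0; [exact: mulr_ge0 (sqr_ge0 _) sum0|exact: ler0n].
Qed.

End sqrt_mean.

Section information_gain.
Context (R : realType).
Implicit Types s a b y : R.

(** The integral of the geometric mean of the normal densities with means 1 and -1
    and standard deviation s. *)
Definition bhattacharyya s : R := expR (- (2 * s ^+ 2)^-1).

(** A lower bound, in nats, for the information that a uniform sign plus normal
    noise of standard deviation s carries about the sign.  It is explicit, so
    that its monotonicity in s can be read off. *)
Definition info_gain s : R := (1 - bhattacharyya s) / 10.

Lemma bhattacharyya_lt1 s : s != 0 -> bhattacharyya s < 1.
Proof.
by move=> s0; rewrite expR_lt1 oppr_lt0 invr_gt0 mulr_gt0// exprn_even_gt0.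
Qed.

Lemma info_gain_gt0 s : s != 0 -> 0 < info_gain s.
Proof. by move=> s0; rewrite divr_gt0// subr_gt0 bhattacharyya_lt1. Qed.

Lemma info_gain_le s : info_gain s <= 10^-1.
Proof.
by rewrite ler_pdivrMr// mulVf// lerBlDr lerDl expR_ge0.
Qed.

Lemma info_gain_decreasing s t : 0 < s -> s < t -> info_gain t < info_gain s.
Proof.
move=> s0 st; have t0 := lt_trans s0 st.
rewrite ltr_pM2r ?invr_gt0// ltrD2l ltrN2 ltr_expR ltrN2.
rewrite ltf_pV2 ?posrE ?mulr_gt0 ?exprn_gt0// ltr_pM2l//.
by rewrite ltrXn2r// ltW.
Qed.

(** The hypotheses on a and b say that they are 1 and -1 in some order, which spares
    the distinction of the two cases. *)
Lemma sqrt_normal_pdf_mul s a b y : s != 0 -> a * b = -1 -> a + b = 0 ->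
  Num.sqrt (normal_pdf a s y * normal_pdf b s y) =
  bhattacharyya s * normal_pdf 0 s y.
Proof.
move=> s0 ab a_b; have pk := normal_peak_ge0 s.
have bE : b = - a by apply/eqP; rewrite -addr_eq0 addrC a_b.
have a2 : a ^+ 2 = 1.
  by move: ab; rewrite bE mulrN => /oppr_inj; rewrite -expr2.
rewrite !normal_pdfE//.
rewrite (_ : _ * _ * _ = (bhattacharyya s * (normal_peak s * normal_fun 0 s y)) ^+ 2).
  by rewrite sqrtr_sqr ger0_norm// !mulr_ge0 ?expR_ge0.
(* The exponents add up to - (y^2 + 1) / s^2, as a^2 = b^2 = 1 and a + b = 0. *)
suff nfE : normal_fun a s y * normal_fun b s y =
    bhattacharyya s ^+ 2 * normal_fun 0 s y ^+ 2.
  by rewrite mulrACA nfE; ring.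
rewrite /normal_fun /bhattacharyya -!expRM_natl -!expRD; congr expR.
rewrite bE.
rewrite (_ : - (y - a) ^+ 2 = - y ^+ 2 + 2 * a * y - a ^+ 2); last by ring.
rewrite (_ : - (y - - a) ^+ 2 = - y ^+ 2 - 2 * a * y - a ^+ 2); last by ring.
by rewrite a2; field.
Qed.

End information_gain.

Section vertices.
Context (R : realType) (d : nat) (s : R).
Hypothesis s0 : s != 0.
Local Notation mu := (lebesgue_power R d).
Local Notation L1 f := (mu.-integrable [set: euclidean R d] (EFin \o f)).

Definition sign_pm (b : bool) : R := if b then 1 else -1.

Definition vertex (v : {ffun 'I_d -> bool}) : euclidean R d :=
  [tuple sign_pm (v i) | i < d].

Lemma cube_vertex v : cube (vertex v).
Proof.
by move=> i; rewrite tnth_mktuple /sign_pm; case: (v i); apply/andP; split; lra.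
Qed.

Lemma uniform_law_ge0 (I : finType) (i : I) : 0 <= #|I|%:R^-1 :> R.
Proof. by rewrite invr_ge0. Qed.

Lemma uniform_law_sum1 (I : finType) (i0 : I) : \sum_(i : I) #|I|%:R^-1 = 1 :> R.
Proof.
rewrite sumr_const -[LHS]mulr_natl; apply: divff; rewrite pnatr_eq0 -lt0n.
by apply/card_gt0P; exists i0.
Qed.

Definition uniform_law (I : finType) (i0 : I) : finite_law R I :=
  FiniteLaw (@uniform_law_ge0 I) (uniform_law_sum1 i0).

Definition uniform_vertex_law : finite_law R {ffun 'I_d -> bool} :=
  uniform_law [ffun=> true].

(** The coordinates of a uniform vertex are independent uniform signs. *)
Lemma uniform_vertex_pdf y : mixture_pdf s uniform_vertex_law vertex y =
  \prod_i ((normal_pdf 1 s (tnth y i) + normal_pdf (-1) s (tnth y i)) / 2).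
Proof.
transitivity (\sum_(v : {ffun 'I_d -> bool})
    \prod_i (normal_pdf (sign_pm (v i)) s (tnth y i) / 2)).
  apply: eq_bigr => v _; rewrite /= card_ffun card_bool card_ord natrX -exprVn.
  rewrite -[X in _ ^+ X]card_ord -prodr_const -big_split/=.
  by apply: eq_bigr => i _; rewrite mulrC tnth_mktuple.
rewrite -(bigA_distr_bigA (fun i b => normal_pdf (sign_pm b) s (tnth y i) / 2)).
by apply: eq_bigr => i _; rewrite big_bool/= mulrDl.
Qed.

(** The integral of the right-hand side of sqrt_mean_le when q and r are the normal
    densities with means 1 and -1. *)
Definition sqrt_bound : R := 1 - (1 - bhattacharyya s) / 20.

Lemma sqrt_bound_gt0 : 0 < sqrt_bound.
Proof.
have := expR_ge0 (- (2 * s ^+ 2)^-1).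
by rewrite /sqrt_bound -/(bhattacharyya s); lra.
Qed.

Lemma ln_sqrt_bound : info_gain s <= - 2 * ln sqrt_bound.
Proof.
have := ln_le_subr1 sqrt_bound_gt0; rewrite /sqrt_bound /info_gain; lra.
Qed.

(** The integrand factors over the coordinates, and each factor is at most the
    combination of normal densities given by sqrt_mean_le. *)
Lemma integral_sqrt_vertex v :
  (\int[mu]_y (Num.sqrt (gaussian_pdf s (vertex v) y *
    mixture_pdf s uniform_vertex_law vertex y))%:E <= (sqrt_bound ^+ d)%:E)%E.
Proof.
pose g i (y : measurableTypeR R) : R := 29 / 40 * normal_pdf (sign_pm (v i)) s y +
  9 / 40 * normal_pdf (sign_pm (~~ v i)) s y +
  2 / 40 * (bhattacharyya s * normal_pdf 0 s y).
have npi m : (@lebesgue_measure R).-integrable [set: measurableTypeR R]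
    (EFin \o normal_pdf m s) by exact: integrable_normal_pdf.
have gi i : (@lebesgue_measure R).-integrable [set: measurableTypeR R] (EFin \o g i).
  by apply: integrableD_EFin; [apply: integrableD_EFin|]; do !apply: integrableZ_EFin.
have g0 i y : 0 <= g i y.
  by rewrite !addr_ge0// !mulr_ge0 ?normal_pdf_ge0 ?expR_ge0.
have Eg i : (\int[lebesgue_measure]_y (g i y)%:E = sqrt_bound%:E)%E.
  have n1 m : \int[lebesgue_measure]_y normal_pdf m s y = 1.
    by rewrite /Rintegral integral_normal_pdf.
  rewrite -[LHS]fineK; last exact: integrable_fin_num (gi i).
  congr EFin; rewrite -/(Rintegral _ _ _) /g RintegralD//; last 2 first.
  - by apply: integrableD_EFin; exact: integrableZ_EFin.
  - by do !apply: integrableZ_EFin.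
  rewrite RintegralD//; [|exact: integrableZ_EFin..].
  rewrite !RintegralZl//; last exact: integrableZ_EFin.
  rewrite !n1 /sqrt_bound; lra.
have mg i : measurable_fun [set: measurableTypeR R] (g i).
  exact: integrable_measurable (gi i).
apply: (@le_trans _ _ (\int[mu]_y (\prod_i g i (tnth y i))%:E)%E); last first.
  rewrite /lebesgue_power ge0_integral_product_power//.
  by rewrite (eq_bigr _ (fun i _ => Eg i)) prodEFin prodr_const card_ord.
apply: ge0_le_integral => //.
- apply/measurable_EFinP.
  exact: measurable_sqrt_gaussian_mixture.
- by apply/measurable_EFinP; exact: measurable_prod_tnth.
move=> y _; rewrite lee_fin uniform_vertex_pdf /gaussian_pdf -big_split/=.
rewrite sqrtr_prod => [|i]; last by rewrite !mulr_ge0 ?addr_ge0 ?normal_pdf_ge0.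
apply: ler_prod => i _; rewrite sqrtr_ge0/= tnth_mktuple /g.
have q0 b := normal_pdf_ge0 (sign_pm b) s (tnth y i).
apply: le_trans (le_trans (sqrt_mean_le (q0 (v i)) (q0 (~~ v i))) _).
  rewrite le_eqVlt; apply/orP; left; apply/eqP; congr (Num.sqrt (_ * (_ / _))).
  by rewrite /sign_pm; case: (v i) => //=; rewrite addrC.
rewrite lerD2l ler_pM2l// sqrt_normal_pdf_mul//.
- by rewrite /sign_pm; case: (v i); rewrite /= ?mulr1 ?mul1r.
- by rewrite /sign_pm; case: (v i); rewrite /= ?subrr ?addNr.
Qed.

Lemma uniform_vertex_entropy_ge :
  gaussian_entropy d s + d%:R * info_gain s <=
  mixture_entropy s uniform_vertex_law vertex.
Proof.
apply: le_trans (mixture_entropy_ge s0 _ integral_sqrt_vertex); last first.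
  by rewrite exprn_gt0// sqrt_bound_gt0.
have := ler_wpM2l (ler0n R d) ln_sqrt_bound.
rewrite lnXn ?sqrt_bound_gt0// -[ln _ *+ d]mulr_natl; lra.
Qed.

Lemma bernoulli_law_ge0 (c : R) : 0 <= c <= 1 ->
  forall b : bool, 0 <= if b then c else 1 - c.
Proof. by move=> /andP[c0 c1] [] //; rewrite subr_ge0. Qed.

Lemma bernoulli_law_sum1 (c : R) : \sum_(b : bool) (if b then c else 1 - c) = 1.
Proof. by rewrite big_bool/= addrC subrK. Qed.

Definition bernoulli_law (c : R) (c01 : 0 <= c <= 1) : finite_law R bool :=
  FiniteLaw (bernoulli_law_ge0 c01) (bernoulli_law_sum1 c).

Definition antipodal_vertex (b : bool) : euclidean R d := vertex [ffun=> b].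

(** Here f is not a product, but the integral of the geometric mean of the densities
    at the two opposite vertices is the d-th power of the Bhattacharyya
    coefficient, hence at most the coefficient itself. *)
Lemma antipodal_entropy_ge (c : R) (c01 : 0 <= c <= 1) : (0 < d)%N -> c = 1 / 2 ->
  gaussian_entropy d s + info_gain s <=
  mixture_entropy s (bernoulli_law c01) antipodal_vertex.
Proof.
move=> d0 cE; pose phi b := gaussian_pdf s (antipodal_vertex b).
pose g b y := 29 / 40 * phi b y + 9 / 40 * phi (~~ b) y +
  2 / 40 * (bhattacharyya s ^+ d * gaussian_pdf s [tuple 0 | _ < d] y).
have gi b : L1 (g b).
  by apply: integrableD_EFin; [apply: integrableD_EFin|]; do !apply: integrableZ_EFin;
    exact: integrable_gaussian_pdf.
have g_ge b y : Num.sqrt (phi b y * mixture_pdf s (bernoulli_law c01) antipodal_vertex y) <=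
    g b y.
  have q0 b' : 0 <= phi b' y by exact: gaussian_pdf_ge0.
  rewrite (_ : mixture_pdf _ _ _ _ = (phi b y + phi (~~ b) y) / 2); last first.
    by rewrite /mixture_pdf big_bool/= cE /phi; case: b => /=; lra.
  apply: le_trans (sqrt_mean_le (q0 b) (q0 (~~ b))) _; rewrite lerD2l ler_pM2l//.
  rewrite le_eqVlt; apply/orP; left; apply/eqP.
  rewrite /phi /gaussian_pdf -big_split/= sqrtr_prod => [|i]; last first.
    by rewrite mulr_ge0 ?normal_pdf_ge0.
  rewrite -[X in _ ^+ X]card_ord -prodr_const -big_split/=.
  apply: eq_bigr => i _; rewrite !tnth_mktuple !ffunE sqrt_normal_pdf_mul//.
  - by case: b; rewrite /sign_pm /= ?mulr1 ?mul1r.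
  - by case: b; rewrite /sign_pm /= ?subrr ?addNr.
have sqrtK b : (\int[mu]_y (Num.sqrt (gaussian_pdf s (antipodal_vertex b) y *
    mixture_pdf s (bernoulli_law c01) antipodal_vertex y))%:E <= sqrt_bound%:E)%E.
  apply: (@le_trans _ _ (\int[mu]_y (g b y)%:E)%E).
    apply: ge0_le_integral => //.
    - apply/measurable_EFinP.
      exact: measurable_sqrt_gaussian_mixture.
    - by apply/measurable_EFinP; exact: integrable_measurable (gi b).
    - by move=> y _; rewrite lee_fin g_ge.
  rewrite -[leLHS]fineK; last exact: integrable_fin_num (gi b).
  rewrite lee_fin -/(Rintegral _ _ _) /g.
  have phii b' : L1 (phi b') by exact: integrable_gaussian_pdf.
  have phi0i := integrable_gaussian_pdf s [tuple 0 | _ < d].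
  rewrite RintegralD//; last 2 first.
  - by apply: integrableD_EFin; exact: integrableZ_EFin.
  - by do !apply: integrableZ_EFin.
  rewrite RintegralD//; [|exact: integrableZ_EFin..].
  rewrite !RintegralZl//; last exact: integrableZ_EFin.
  rewrite !Rintegral_gaussian_pdf.
  have : bhattacharyya s ^+ d <= bhattacharyya s.
    rewrite -[leRHS]expr1; apply: ler_wiXn2l => //; first exact: expR_ge0.
    exact/ltW/bhattacharyya_lt1.
  rewrite /sqrt_bound; lra.
apply: le_trans _ (mixture_entropy_ge s0 sqrt_bound_gt0 sqrtK).
by have := ln_sqrt_bound; lra.
Qed.

End vertices.

(** * Testing with finitely supported priors *)

Section two_point_test.
Context (R : realType).

Lemma sum_ffun_prod (I : finType) (n : nat) (F : 'I_n -> I -> R) :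
  \sum_(j : {ffun 'I_n -> I}) \prod_l F l (j l) = \prod_l \sum_i F l i.
Proof. by rewrite bigA_distr_bigA. Qed.

(** The factor on the left is a lower bound for the minimum of P and Q: it is
    Q minus a nonnegative term, and P minus (Q / 2 - P)^2 / P.  The minimum times
    the distance from a to b is a lower bound by the triangle inequality. *)
Lemma chi_square_overlap (P Q a b H : R) : 0 < P -> 0 <= Q -> a <= b ->
  (Q - 4^-1 * (Q ^+ 2 / P)) * (b - a) <= P * `|a - H| + Q * `|b - H|.
Proof.
move=> P0 Q0 ab; set m := _ - _.
have mP : m <= P.
  rewrite -subr_ge0 (_ : P - m = (Q / 2 - P) ^+ 2 / P); last first.
    by rewrite /m; field; rewrite gt_eqF.
  by rewrite divr_ge0 ?sqr_ge0 1?ltW.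
have mQ : m <= Q.
  by rewrite gerBl mulr_ge0 ?invr_ge0// divr_ge0 ?sqr_ge0// ltW.
have [m0|m0] := lerP m 0.
  apply: (@le_trans _ _ 0); first by rewrite mulr_le0_ge0// subr_ge0.
  by rewrite addr_ge0// mulr_ge0// ltW.
apply: (@le_trans _ _ (m * `|a - H| + m * `|b - H|)); last first.
  by rewrite lerD// ler_wpM2r.
rewrite -mulrDr ler_pM2l//.
have := ler_norm (b - H); have := ler_norm (- (a - H)); rewrite normrN; lra.
Qed.

(** The chi-square divergence tensorizes: for n samples, 1 + chi is raised to the
    power n, which is at most 2 here, so the two laws of the samples overlap by
    at least one half. *)
Lemma two_point_risk (I : finType) (n : nat) (p q : finite_law R I)
    (H : {ffun 'I_n -> I} -> R) (a b chi eta : R) :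
  (forall i, 0 < p i) -> a <= b ->
  \sum_i q i ^+ 2 / p i = 1 + chi -> 0 <= chi -> n%:R * chi <= ln 2 ->
  \sum_(j : {ffun 'I_n -> I}) \prod_l p (j l) * `|a - H j| <= eta ->
  \sum_(j : {ffun 'I_n -> I}) \prod_l q (j l) * `|b - H j| <= eta ->
  b - a <= 4 * eta.
Proof.
move=> p0 ab chiE chi0 nchi pa qb.
have Psum : \sum_(j : {ffun 'I_n -> I}) \prod_l q (j l) = 1.
  rewrite (sum_ffun_prod (fun _ => q)).
  by rewrite big1// => l _; exact: law_sum1.
have Csum : \sum_(j : {ffun 'I_n -> I})
    (\prod_l q (j l)) ^+ 2 / \prod_l p (j l) = (1 + chi) ^+ n.
  transitivity (\sum_(j : {ffun 'I_n -> I}) \prod_l (q (j l) ^+ 2 / p (j l))).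
    by apply: eq_bigr => j _; rewrite -prodrXl -prodfV -big_split.
  by rewrite (sum_ffun_prod (fun _ i => q i ^+ 2 / p i)) chiE prodr_const card_ord.
have Cle : (1 + chi) ^+ n <= 2.
  apply: (@le_trans _ _ (expR chi ^+ n)).
    by rewrite lerXn2r ?nnegrE ?expR_ge0 ?addr_ge0 ?expR_ge1Dx.
  by rewrite -expRM_natl -[leRHS](@lnK _ 2) ?posrE// ler_expR.
have : \sum_(j : {ffun 'I_n -> I}) (\prod_l q (j l) -
    4^-1 * ((\prod_l q (j l)) ^+ 2 / \prod_l p (j l))) * (b - a) <= eta + eta.
  apply: le_trans (lerD pa qb); rewrite -big_split/=; apply: ler_sum => j _.
  apply: chi_square_overlap => //; first exact: prodr_gt0.
  by apply: prodr_ge0 => l _; exact: law_ge0.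
rewrite -mulr_suml sumrB -mulr_sumr Psum Csum => h.
have : (1 - 4^-1 * 2) * (b - a) <= (1 - 4^-1 * (1 + chi) ^+ n) * (b - a).
  by rewrite ler_wpM2r ?subr_ge0// lerD2l lerN2 ler_pM2l// invr_gt0.
lra.
Qed.

End two_point_test.

Section birthday_test.
Context (R : realType) (n k : nat) (V : finType).

(** The option type records the origin of each sample: None is the fixed point,
    Some m the m-th codeword.  The fixed point may be drawn any number of times. *)
Definition collision_free (j : {ffun 'I_n -> option 'I_k}) : bool :=
  [forall l, forall l', (j l == j l') && (j l != None) ==> (l == l')].

Lemma le_sum_term (I : finType) (P : pred I) (F : I -> R) (i : I) :
  P i -> (forall i, 0 <= F i) -> F i <= \sum_(i | P i) F i.
Proof. by move=> Pi F0; rewrite (bigD1 i)//= lerDl sumr_ge0. Qed.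

Section law_of_sample.
Variables (w : finite_law R (option 'I_k)) (e : R).
Hypothesis wE : forall m, w (Some m) = e / k%:R.

(** Expand the probability that the draws l and l' both equal m as a product over
    the draws: each of these two contributes e / k, the others contribute 1. *)
Lemma collision_prob (l l' : 'I_n) (m : 'I_k) : l != l' ->
  \sum_(j : {ffun 'I_n -> option 'I_k})
    (if (j l == Some m) && (j l' == Some m) then \prod_i w (j i) else 0) <=
  (e / k%:R) ^+ 2.
Proof.
move=> ll'.
pose F i (o : option 'I_k) : R :=
  if ((i == l) || (i == l')) && (o != Some m) then 0 else w o.
apply: (@le_trans _ _ (\sum_(j : {ffun 'I_n -> option 'I_k}) \prod_i F i (j i))).
  apply: ler_sum => j _; case: ifPn => [/andP[/eqP jl /eqP jl']|_]; last first.
    by apply: prodr_ge0 => i _; rewrite /F; case: ifP => // _; exact: law_ge0.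
  rewrite le_eqVlt; apply/orP; left; apply/eqP/eq_bigr => i _; rewrite /F.
  have [->|il] := eqVneq i l; first by rewrite jl eqxx.
  by have [->|il'] := eqVneq i l'; first by rewrite jl' eqxx.
rewrite sum_ffun_prod.
have F1 i : (i == l) || (i == l') -> \sum_o F i o = e / k%:R.
  move=> il; rewrite (bigD1 (Some m))//= /F il eqxx/= wE big1 ?addr0// => o ->.
  by [].
have F2 i : i != l -> i != l' -> \sum_o F i o = 1.
  move=> /negPf il /negPf il'; rewrite -(law_sum1 w); apply: eq_bigr => o _.
  by rewrite /F il il'.
rewrite (bigD1 l)//= F1 ?eqxx// (bigD1 l')/=; last by rewrite eq_sym.
rewrite F1 ?eqxx ?orbT// big1 ?mulr1 ?expr2// => i /andP[il il'].
exact: F2.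
Qed.

(** Union bound over pairs of draws and over codewords. *)
Lemma collision_free_prob : (0 < k)%N ->
  1 - (n%:R * e) ^+ 2 / k%:R <=
  \sum_(j : {ffun 'I_n -> option 'I_k} | collision_free j) \prod_l w (j l).
Proof.
move=> k0.
pose C (l l' : 'I_n) (m : 'I_k) (j : {ffun 'I_n -> option 'I_k}) : R :=
  if (j l == Some m) && (j l' == Some m) then \prod_i w (j i) else 0.
have W0 (j : {ffun 'I_n -> option 'I_k}) : 0 <= \prod_l w (j l).
  by apply: prodr_ge0 => l _; exact: law_ge0.
have C0 l l' m j : 0 <= C l l' m j by rewrite /C; case: ifP.
have tot : \sum_(j : {ffun 'I_n -> option 'I_k}) \prod_l w (j l) = 1.
  rewrite (sum_ffun_prod (fun _ => w)).
  by rewrite big1// => l _; exact: law_sum1.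
rewrite lerBlDr -[leLHS]tot [leLHS](bigID collision_free)/= lerD2l.
apply: (@le_trans _ _ (\sum_j \sum_l \sum_(l' | l != l') \sum_m C l l' m j)).
  rewrite big_mkcond; apply: ler_sum => j _.
  have S0 : 0 <= \sum_l \sum_(l' | l != l') \sum_m C l l' m j.
    by do 3! (apply: sumr_ge0 => ? _).
  case: ifPn => //; rewrite /collision_free negb_forall => /existsP[l].
  rewrite negb_forall => /existsP[l']; rewrite negb_imply => /andP[/andP[/eqP jj]].
  case jl : (j l) => [m|]// _ ll'.
  have -> : \prod_i w (j i) = C l l' m j by rewrite /C -jj jl eqxx.
  apply: (@le_trans _ _ (\sum_m C l l' m j)).
    exact: (le_sum_term (F := fun m => C l l' m j)).
  apply: (@le_trans _ _ (\sum_(l' | l != l') \sum_m C l l' m j)).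
    by apply: (le_sum_term (F := fun l' => \sum_m C l l' m j)) => // l1; exact: sumr_ge0.
  apply: (le_sum_term (F := fun l => \sum_(l' | l != l') \sum_m C l l' m j)) => // l1.
  by do 2! (apply: sumr_ge0 => ? _).
rewrite exchange_big/=.
apply: (@le_trans _ _ (\sum_(l < n) \sum_(l' < n) \sum_(m < k) (e / k%:R) ^+ 2)).
  apply: ler_sum => l _; rewrite exchange_big/= big_mkcond/=.
  apply: ler_sum => l' _; case: ifPn => [ll'|_]; last first.
    by rewrite sumr_ge0// => m _; rewrite sqr_ge0.
  by rewrite exchange_big/=; apply: ler_sum => m _; exact: collision_prob.
rewrite !sumr_const !card_ord.
rewrite (_ : (e / k%:R) ^+ 2 *+ k *+ n *+ n =
    (e / k%:R) ^+ 2 * k%:R * n%:R * n%:R); last first.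
  by rewrite !mulr_natr.
rewrite le_eqVlt; apply/orP; left; apply/eqP.
by field; rewrite pnatr_eq0 -lt0n.
Qed.

End law_of_sample.

Definition codebook_sample (c : {ffun 'I_k -> V}) (j : {ffun 'I_n -> option 'I_k}) :
  {ffun 'I_n -> option V} := [ffun l => omap c (j l)].

(** What the samples would be if every draw of a codeword were replaced with a new
    independent symbol. *)
Definition fresh_sample (u : {ffun 'I_n -> V}) (j : {ffun 'I_n -> option 'I_k}) :
  {ffun 'I_n -> option V} := [ffun l => omap (fun=> u l) (j l)].

(** Averaging over codebooks c and over independent symbols u, exchange the codeword
    of index m with the symbol u l of the one draw l that uses m.  This is an
    involution on the pairs (c, u), and it turns the samples read in the
    codebook into the fresh symbols. *)
Lemma sum_codebook_sample (j : {ffun 'I_n -> option 'I_k})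
    (H : {ffun 'I_n -> option V} -> R) : collision_free j ->
  \sum_(c : {ffun 'I_k -> V}) \sum_(u : {ffun 'I_n -> V}) H (codebook_sample c j) =
  \sum_(c : {ffun 'I_k -> V}) \sum_(u : {ffun 'I_n -> V}) H (fresh_sample u j).
Proof.
move=> free_j.
have inj l l' m : j l = Some m -> j l' = Some m -> l = l'.
  move=> jl jl'; have /forallP/(_ l)/forallP/(_ l') := free_j.
  by rewrite jl jl' eqxx => /eqP.
pose swap (z : {ffun 'I_k -> V} * {ffun 'I_n -> V}) :
    {ffun 'I_k -> V} * {ffun 'I_n -> V} :=
  ([ffun m => if [pick l | j l == Some m] is Some l then z.2 l else z.1 m],
   [ffun l => if j l is Some m then z.1 m else z.2 l]).
have swapK : involutive swap.
  move=> [c u]; rewrite /swap/=; congr pair; apply/ffunP => i; rewrite !ffunE.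
    by case: pickP => [l /eqP jl|]; rewrite ?ffunE ?jl.
  case jl : (j i) => [m|]//; rewrite ffunE; case: pickP => [l /eqP jl'|/(_ i)].
    by rewrite (inj _ _ _ jl jl').
  by rewrite jl eqxx.
rewrite !pair_bigA/= (reindex_inj (inv_inj swapK))/=.
apply: eq_bigr => -[c u] _; congr H; apply/ffunP => l; rewrite !ffunE/=.
case jl : (j l) => [m|]//=; rewrite ffunE; case: pickP => [l' /eqP jl'|/(_ l)].
  by rewrite (inj _ _ _ jl jl').
by rewrite jl eqxx.
Qed.

(** On a collision-free sequence of draws, the estimator has the same average over
    codebooks as over fresh symbols, so its two average errors add up to at least
    b - a. *)
Lemma birthday_risk (w : finite_law R (option 'I_k)) (e : R)
    (H : {ffun 'I_n -> option V} -> R) (A : {ffun 'I_k -> V} -> R)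
    (a b B eta : R) (v0 : V) :
  (0 < k)%N -> (forall m, w (Some m) = e / k%:R) -> a <= b -> b <= B ->
  (forall c, A c <= a) ->
  (forall c, \sum_(j : {ffun 'I_n -> option 'I_k})
    \prod_l w (j l) * `|A c - H (codebook_sample c j)| <= eta) ->
  \sum_(j : {ffun 'I_n -> option 'I_k}) \sum_(u : {ffun 'I_n -> V})
    \prod_l w (j l) * #|{ffun 'I_n -> V}|%:R^-1 * `|B - H (fresh_sample u j)| <= eta ->
  (1 - (n%:R * e) ^+ 2 / k%:R) * (b - a) <= 2 * eta.
Proof.
move=> k0 wE ab bB Aa riskA riskB.
set N := #|{ffun 'I_n -> V}|%:R in riskB; pose M : R := #|{ffun 'I_k -> V}|%:R.
have N0 : 0 < N by rewrite ltr0n; apply/card_gt0P; exists [ffun=> v0].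
have M0 : 0 < M by rewrite ltr0n; apply/card_gt0P; exists [ffun=> v0].
have sumN (r : R) : \sum_(u : {ffun 'I_n -> V}) r = N * r.
  by rewrite sumr_const [RHS]mulr_natl.
have sumM (r : R) : \sum_(c : {ffun 'I_k -> V}) r = M * r.
  by rewrite sumr_const [RHS]mulr_natl.
pose W (j : {ffun 'I_n -> option 'I_k}) := \prod_l w (j l).
have W0 j : 0 <= W j by apply: prodr_ge0 => l _; exact: law_ge0.
pose EA j := M^-1 * \sum_c `|A c - H (codebook_sample c j)|.
pose EB j := N^-1 * \sum_u `|B - H (fresh_sample u j)|.
have EA0 j : 0 <= EA j.
  by apply: mulr_ge0; [rewrite invr_ge0 ltW|exact: sumr_ge0].
have EB0 j : 0 <= EB j.
  by apply: mulr_ge0; [rewrite invr_ge0 ltW|exact: sumr_ge0].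
have sumA : \sum_j W j * EA j <= eta.
  rewrite (_ : \sum_j _ = M^-1 * \sum_c \sum_j W j * `|A c - H (codebook_sample c j)|).
    by rewrite mulrC ler_pdivrMr// mulrC -sumM; apply: ler_sum => c _; exact: riskA.
  rewrite exchange_big/= mulr_sumr; apply: eq_bigr => j _.
  by rewrite /EA mulrCA mulr_sumr.
have sumB : \sum_j W j * EB j <= eta.
  apply: le_trans riskB; rewrite le_eqVlt; apply/orP; left; apply/eqP.
  by apply: eq_bigr => j _; rewrite /EB mulrA mulr_sumr.
have good j : collision_free j -> b - a <= EA j + EB j.
  move=> free_j; have dfE := sum_codebook_sample H free_j.
  have E : M^-1 * \sum_c H (codebook_sample c j) = N^-1 * \sum_u H (fresh_sample u j).
    move: dfE; rewrite sumM.
    under eq_bigr do rewrite sumN.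
    rewrite -mulr_sumr => dfE.
    rewrite (_ : \sum_c H (codebook_sample c j) = N^-1 * (M * \sum_u H (fresh_sample u j))).
      by rewrite mulrCA mulKf ?gt_eqF.
    by rewrite -dfE mulKf ?gt_eqF.
  have hA : M^-1 * \sum_c H (codebook_sample c j) - a <= EA j.
    rewrite -[a](mulKf (lt0r_neq0 M0)) -sumM -mulrBr -sumrB ler_pM2l ?invr_gt0//.
    apply: ler_sum => c _; have := Aa c; have := ler_norm (- (A c - H (codebook_sample c j))).
    by rewrite normrN; lra.
  have hB : b - N^-1 * \sum_u H (fresh_sample u j) <= EB j.
    rewrite -[b](mulKf (lt0r_neq0 N0)) -sumN -mulrBr -sumrB ler_pM2l ?invr_gt0//.
    apply: ler_sum => u _; have := ler_norm (B - H (fresh_sample u j)); lra.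
  by lra.
apply: (@le_trans _ _ (\sum_(j | collision_free j) W j * (b - a))).
  by rewrite -mulr_suml ler_wpM2r ?subr_ge0// collision_free_prob.
apply: (@le_trans _ _ (\sum_j W j * (EA j + EB j))); last first.
  by under eq_bigr do rewrite mulrDr; rewrite big_split/=; lra.
rewrite big_mkcond; apply: ler_sum => j _; case: ifPn => [free_j|_].
  by rewrite ler_wpM2l// good.
by rewrite mulr_ge0// addr_ge0.
Qed.

End birthday_test.

(** * Minimax risk and the test between two nearby laws *)

Section risk_of_mixtures.
Context (R : realType).

(** The infimum over estimators need not be attained, whence the factor 2. *)
Lemma estimator_of_minimax (n d : nat) (s eta : R) : s != 0 -> 0 < eta ->
  (minimax_risk n s (supported_in_cube R d) <= eta%:E)%E ->
  exists h : n.-tuple (euclidean R d) -> R,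
    forall (I : finType) (p : finite_law R I) (x : I -> euclidean R d),
    (forall i, cube (x i)) ->
    \sum_(j : {ffun 'I_n -> I}) \prod_l p (j l) *
      `|mixture_entropy s p x - h [tuple x (j l) | l < n]| <= 2 * eta.
Proof.
move=> s0 eta0 risk.
have : (minimax_risk n s (supported_in_cube R d) < (2 * eta)%:E)%E.
  by apply: le_lt_trans risk _; rewrite lte_fin; lra.
move=> /ereal_inf_lt[_ [h _ <-]] sup_lt; exists h => I p x xcube.
have risk_le : (absolute_risk s h (mixture p x) <= (2 * eta)%:E)%E.
  apply: le_trans (ltW sup_lt); apply: ereal_sup_ubound.
  by exists (mixture p x) => //; exact: mixture_supported_in_cube.
rewrite -lee_fin; apply: le_trans risk_le.
rewrite /absolute_risk differential_entropy_mixtureE//.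
rewrite (ge0_integral_product_power_mixture p x
  (G := fun t => `|(mixture_entropy s p x)%:E - (h t)%:E|%E))//.
- by rewrite -sumEFin.
- apply: measurableT_comp => //; apply: emeasurable_funB => //.
  by apply/measurable_EFinP; exact: measurable_funPT.
Qed.

End risk_of_mixtures.

Section two_point_bound.
Context (R : realType).

(** For the mass t^2 the bound is 2 t: use - ln t <= 1 / t - 1 for the first term,
    while the second term is at most t^2. *)
Lemma bernoulli_entropy_le (t : R) : 0 < t < 1 ->
  - (t ^+ 2 * ln (t ^+ 2) + (1 - t ^+ 2) * ln (1 - t ^+ 2)) <= 2 * t.
Proof.
move=> /andP[t0 t1].
have tt : t * t = t ^+ 2 by rewrite expr2.
have p1 : 0 < 1 - t ^+ 2 by nra.
have h1 := mulr_ln_tangent (ltW p1) ltr01.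
have h2 := mulr_ln_tangent (ltW t0) ltr01.
rewrite ln1 mulr0 add0r in h1; rewrite ln1 mulr0 add0r in h2.
have -> : ln (t ^+ 2) = 2 * ln t by rewrite lnXn// mulr_natl.
have : t * (t - 1) <= t * (t * ln t) by exact: (ler_wpM2l (ltW t0) h2).
have := mulr_ge0 (ltW t0) (ltW t0).
rewrite -tt in h1 *; lra.
Qed.

(** The entropy is at most h_N + J / 2 at p0 and at least h_N + J at 1 / 2, and
    a concave function grows between p0 and p1 at least as fast, on average, as
    between p0 and 1 / 2. *)
Lemma two_point_gap (d : nat) (s p0 p1 : R) (c0 : 0 <= p0 <= 1)
    (c1 : 0 <= p1 <= 1) : s != 0 -> (0 < d)%N ->
  p0 = (info_gain s / 4) ^+ 2 -> p0 <= p1 <= 1 / 2 ->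
  (p1 - p0) * info_gain s <=
  mixture_entropy s (bernoulli_law c1) (@antipodal_vertex R d) -
  mixture_entropy s (bernoulli_law c0) (@antipodal_vertex R d).
Proof.
move=> s0 d0 p0E /andP[p01 p12].
have J0 := info_gain_gt0 s0; have J1 := info_gain_le s.
have t01 : 0 < info_gain s / 4 < 1.
  move: (info_gain s) J0 J1 => J J0 J1; apply/andP; split; lra.
have p0le : p0 < 1 / 2.
  rewrite p0E; move: (info_gain s) J0 J1 => J J0 J1; nra.
have F0 : mixture_entropy s (bernoulli_law c0) (@antipodal_vertex R d) <=
    gaussian_entropy d s + info_gain s / 2.
  apply: le_trans (mixture_entropy_le s0 _ _) _.
  rewrite big_bool/= lerD2l p0E; apply: le_trans (bernoulli_entropy_le t01) _.
  by move: (info_gain s) => J; lra.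
have ch : 0 <= (1 / 2 : R) <= 1 by apply/andP; split; lra.
have Fh : gaussian_entropy d s + info_gain s <=
    mixture_entropy s (bernoulli_law ch) (@antipodal_vertex R d).
  exact: antipodal_entropy_ge.
have q0 : 0 < 1 / 2 - p0 by rewrite subr_gt0.
(* p1 = (1 - c) p0 + c / 2 *)
pose c := (p1 - p0) / (1 / 2 - p0).
have cE : c * (1 / 2 - p0) = p1 - p0 by rewrite /c divfK// gt_eqF.
have cge0 : 0 <= c by rewrite divr_ge0 ?subr_ge0// ltW.
have c01 : 0 <= c <= 1.
  by rewrite cge0/= ler_pdivrMr//; clear -p12; lra.
have p0_ge0 : 0 <= p0 by case/andP: (c0).
clearbody c; have F1 := @mixture_entropy_concave R d s s0 c bool bool bool
  (bernoulli_law c0) (@antipodal_vertex R d) (bernoulli_law ch) (@antipodal_vertex R d)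
  (bernoulli_law c1) (@antipodal_vertex R d) c01 _.
have {F1} := F1 _; rewrite -cE.
move: (mixture_entropy _ (bernoulli_law c0) _) F0 => f0 F0.
move: (mixture_entropy _ (bernoulli_law ch) _) Fh => fh Fh F1.
have : (1 - c) * f0 + c * fh <=
    mixture_entropy s (bernoulli_law c1) (@antipodal_vertex R d).
  apply: F1 => y; rewrite /mixture_pdf !big_bool/= -(subrK p0 p1) -cE.
  move: (gaussian_pdf _ _ _) (gaussian_pdf _ _ _) => a b; clear; lra.
move: (mixture_entropy _ _ _) => f1 {}F1.
have : c * ((1 / 2 - p0) * info_gain s) <= c * (fh - f0).
  rewrite ler_wpM2l//; move: (info_gain s) (gaussian_entropy d s) J0 F0 Fh => J g J0 F0 Fh.
  by clear -J0 F0 Fh p0_ge0; nra.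
by move: (info_gain s) F1 => J F1; clear -F1; lra.
Qed.

Lemma two_point_chi_square (eta J p0 e : R) : 0 < J -> J <= 10^-1 ->
  p0 = (J / 4) ^+ 2 -> e = 9 * eta / J ->
  e ^+ 2 / p0 + e ^+ 2 / (1 - p0) <= 2592 * eta ^+ 2 / J ^+ 4.
Proof.
move=> J0 J1 p0E eE.
have -> : 2592 * eta ^+ 2 / J ^+ 4 = e ^+ 2 / p0 + e ^+ 2 / p0.
  by rewrite eE p0E; field; rewrite gt_eqF.
have p00 : 0 < p0 by rewrite p0E exprn_gt0// divr_gt0.
have p0le : p0 <= 1 / 2 by rewrite p0E; nra.
rewrite lerD2l ler_wpM2l ?sqr_ge0//.
by clear -p00 p0le; rewrite lef_pV2 ?posrE; lra.
Qed.

(** The perturbation e = 9 eta / J makes the entropy gap 9 eta, just more than the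
    8 eta allowed by two_point_risk for the error 2 eta. *)
Lemma two_point_bound (n d : nat) (s eta : R) : s != 0 -> (0 < d)%N ->
  0 < eta -> eta <= info_gain s / 36 ->
  (minimax_risk n s (supported_in_cube R d) <= eta%:E)%E ->
  ln 2 * info_gain s ^+ 4 <= 2592 * eta ^+ 2 * n%:R.
Proof.
move=> s0 d0 eta0 etaJ risk.
have [h hrisk] := estimator_of_minimax s0 eta0 risk.
have J0 := info_gain_gt0 s0; have J1 := info_gain_le s.
pose p0 := (info_gain s / 4) ^+ 2; pose e := 9 * eta / info_gain s.
have chi_le : e ^+ 2 / p0 + e ^+ 2 / (1 - p0) <= 2592 * eta ^+ 2 / info_gain s ^+ 4.
  exact: two_point_chi_square.
have p00 : 0 < p0 by rewrite exprn_gt0// divr_gt0.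
have p0le : p0 <= 1 / 4.
  by rewrite /p0; move: (info_gain s) J0 J1 => J J0 J1; clear -J0 J1; nra.
have p0E : p0 = (info_gain s / 4) ^+ 2 by [].
have e0 : 0 < e by rewrite divr_gt0// mulr_gt0.
have eJ : e * info_gain s = 9 * eta by rewrite /e divfK// gt_eqF.
have e4 : e <= 1 / 4.
  rewrite /e ler_pdivrMr//; move: (info_gain s) etaJ => J etaJ; clear -etaJ; lra.
clearbody p0 e.
have c0 : 0 <= p0 <= 1 by clear -p00 p0le; apply/andP; split; lra.
have c1 : 0 <= p0 + e <= 1 by clear -p00 p0le e0 e4; apply/andP; split; lra.
have p01 : p0 <= p0 + e <= 1 / 2 by clear -p00 p0le e0 e4; apply/andP; split; lra.
have := two_point_gap c0 c1 s0 d0 p0E p01.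
rewrite addrAC subrr add0r eJ => gap.
rewrite leNgt; apply/negP => small.
have etale : 0 <= 9 * eta by rewrite mulr_ge0// ltW.
have cubes b : cube (@antipodal_vertex R d b) by exact: cube_vertex.
have risk0 := hrisk bool (bernoulli_law c0) (@antipodal_vertex R d) cubes.
have risk1 := hrisk bool (bernoulli_law c1) (@antipodal_vertex R d) cubes.
have : 9 * eta <= 4 * (2 * eta).
  apply: (le_trans gap).
  apply: (@two_point_risk R bool n (bernoulli_law c0) (bernoulli_law c1)
    (fun j => h [tuple @antipodal_vertex R d (j l) | l < n]) _ _
    (e ^+ 2 / p0 + e ^+ 2 / (1 - p0)) (2 * eta) _ _ _ _ _ risk0 risk1).
  - by case; rewrite /bernoulli_law/=; clear -p00 p0le; lra.
  - by rewrite -subr_ge0; exact: le_trans etale gap.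
  - rewrite big_bool /bernoulli_law/=; clear -p00 p0le; field; apply/andP.
    by split; apply/eqP; lra.
  - have p0' : 0 < 1 - p0 by clear -p00 p0le; lra.
    by rewrite addr_ge0// divr_ge0 ?sqr_ge0// ltW.
  - apply: (@le_trans _ _ (n%:R * (2592 * eta ^+ 2 / info_gain s ^+ 4))).
      by rewrite ler_wpM2l.
    by rewrite mulrA ler_pdivrMr ?exprn_gt0// mulrC ltW.
by clear -eta0; lra.
Qed.

End two_point_bound.

(** * A hidden random codebook *)

Section birthday_bound.
Context (R : realType).

Lemma big_option (I : finType) (F : option I -> R) :
  \sum_o F o = F None + \sum_i F (Some i).
Proof.
rewrite (bigD1 None)//=; congr +%R.
rewrite (reindex_omap (fun i : I => Some i) id) => [|[i|]//].
by apply: eq_bigl => i; rewrite eqxx.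
Qed.

Section codebook_law.
Variables (k : nat) (e : R).
Hypotheses (k0 : (0 < k)%N) (e01 : 0 <= e <= 1).

Lemma codebook_law_ge0 (o : option 'I_k) :
  0 <= if o is Some _ then e / k%:R else 1 - e.
Proof.
by case/andP: (e01) => ? ?; case: o => [_|]; rewrite ?subr_ge0// divr_ge0.
Qed.

Lemma codebook_law_sum1 :
  \sum_(o : option 'I_k) (if o is Some _ then e / k%:R else 1 - e) = 1.
Proof.
rewrite big_option sumr_const card_ord -[_ *+ k]mulr_natr divfK ?subrK//.
by rewrite pnatr_eq0 -lt0n.
Qed.

Definition codebook_law : finite_law R (option 'I_k) :=
  FiniteLaw codebook_law_ge0 codebook_law_sum1.

Lemma codebook_entropy_le : 0 < e < 1 ->
  - \sum_o codebook_law o * ln (codebook_law o) <= e * (1 - ln e + ln k%:R).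
Proof.
move=> /andP[e0 e1]; have kR0 : 0 < k%:R :> R by rewrite ltr0n.
rewrite big_option /= sumr_const card_ord -[_ *+ k]mulr_natr.
rewrite mulrAC divfK ?gt_eqF// ln_div ?posrE//.
have e1' : 0 < 1 - e by rewrite subr_gt0.
have := mulr_ln_tangent (ltW e1') ltr01.
rewrite ln1 mulr0 add0r; lra.
Qed.

Context (V : finType) (v0 : V).

Lemma fresh_law_ge0 (u : option 'I_k * V) : 0 <= codebook_law u.1 * #|V|%:R^-1.
Proof. by rewrite mulr_ge0 ?law_ge0// invr_ge0. Qed.

Lemma fresh_law_sum1 :
  \sum_(u : option 'I_k * V) codebook_law u.1 * #|V|%:R^-1 = 1.
Proof.
rewrite -(pair_bigA _ (fun o (_ : V) => codebook_law o * #|V|%:R^-1))/=.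
rewrite -[RHS](law_sum1 codebook_law); apply: eq_bigr => o _.
by rewrite -mulr_sumr (uniform_law_sum1 R v0) mulr1.
Qed.

(** As a law on symbols this is the mixture of the fixed point and of the uniform
    law; pairing a draw with a fresh symbol indexes its samples like those from a
    codebook. *)
Definition fresh_law : finite_law R (option 'I_k * V)%type :=
  FiniteLaw fresh_law_ge0 fresh_law_sum1.

Lemma sum_fresh_law (n : nat) (G : {ffun 'I_n -> option V} -> R) :
  \sum_(z : {ffun 'I_n -> option 'I_k * V})
    \prod_l fresh_law (z l) * G [ffun l => omap (fun=> (z l).2) (z l).1] =
  \sum_(j : {ffun 'I_n -> option 'I_k}) \sum_(u : {ffun 'I_n -> V})
    \prod_l codebook_law (j l) * #|{ffun 'I_n -> V}|%:R^-1 * G (fresh_sample u j).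
Proof.
rewrite pair_bigA/=.
pose zip (z : {ffun 'I_n -> option 'I_k} * {ffun 'I_n -> V}) :
  {ffun 'I_n -> option 'I_k * V} := [ffun l => (z.1 l, z.2 l)].
rewrite (reindex zip); last first.
  exists (fun z : {ffun 'I_n -> option 'I_k * V} =>
      ([ffun l => (z l).1], [ffun l => (z l).2])) => [[j u]|z] _.
    by congr pair; apply/ffunP => l; rewrite !ffunE.
  by apply/ffunP => l; rewrite !ffunE -surjective_pairing.
apply: eq_bigr => -[j u] _; congr (_ * G _); last first.
  by apply/ffunP => l; rewrite !ffunE.
under eq_bigr do rewrite ffunE/=.
rewrite big_split/= prodr_const card_ord; congr *%R.
by rewrite card_ffun card_ord natrX exprVn.
Qed.

End codebook_law.

(** Relative to h_N, the entropy with fresh vertices is at least e d J, and the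
    entropy with a codebook at most e (1 - ln e + ln k), which is smaller by at
    least a quarter of e d J.  If n draws seldom collide, birthday_risk bounds
    this gap by 8 eta. *)
Lemma birthday_gap_bound (n d k : nat) (s eta e : R) : s != 0 -> 0 < eta ->
  (minimax_risk n s (supported_in_cube R d) <= eta%:E)%E ->
  (0 < k)%N -> 0 < e < 1 -> 4 <= d%:R * info_gain s ->
  - ln e <= d%:R * info_gain s / 4 -> ln k%:R <= d%:R * info_gain s / 4 ->
  (n%:R * e) ^+ 2 <= k%:R / 2 ->
  e * (d%:R * info_gain s) <= 32 * eta.
Proof.
move=> s0 eta0 risk k0 e01 J4 lne lnk small.
have [h hrisk] := estimator_of_minimax s0 eta0 risk.
have e01' : 0 <= e <= 1 by case/andP: (e01) => ? ?; rewrite !ltW.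
pose V := {ffun 'I_d -> bool}; pose v0 : V := [ffun=> true].
pose pt (o : option V) : euclidean R d := vertex R (odflt v0 o).
pose H (o : {ffun 'I_n -> option V}) : R := h [tuple pt (o l) | l < n].
pose w := codebook_law k0 e01'.
pose x (c : {ffun 'I_k -> V}) (o : option 'I_k) := pt (omap c o).
pose A c := mixture_entropy s w (x c).
pose wU := fresh_law k0 e01' v0.
pose xU (u : option 'I_k * V) := pt (omap (fun=> u.2) u.1).
pose B := mixture_entropy s wU xU.
pose a := gaussian_entropy d s + e * (1 - ln e + ln k%:R).
pose b := gaussian_entropy d s + e * (d%:R * info_gain s).
have cubes o : cube (pt o) by exact: cube_vertex.
have e0 : 0 < e by case/andP: e01.
have ba : e * (d%:R * info_gain s) / 4 <= b - a.
  rewrite /b /a; move: (d%:R * info_gain s) (ln e) (ln k%:R) J4 lne lnk => J x1 x2 J4 h1 h2.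
  have : e * (1 - x1 + x2) <= e * (3 * J / 4) by rewrite ler_pM2l//; clear -J4 h1 h2; lra.
  clear; lra.
have ab : a <= b.
  rewrite -subr_ge0; apply: le_trans ba; apply: divr_ge0 => //.
  by apply: mulr_ge0; [exact: ltW|apply: le_trans J4; exact: ler0n].
have Aa c : A c <= a.
  apply: le_trans (mixture_entropy_le s0 _ _) _.
  by rewrite lerD2l codebook_entropy_le.
have bB : b <= B.
  have pdfU y : mixture_pdf s wU xU y =
      (1 - e) * mixture_pdf s (uniform_law R tt) (fun=> vertex R v0) y +
      e * mixture_pdf s (uniform_vertex_law R d) (@vertex R d) y.
    have cardV : (#|V|%:R : R) != 0.
      by rewrite pnatr_eq0 -lt0n; apply/card_gt0P; exists v0.
    have kR : (k%:R : R) != 0 by rewrite pnatr_eq0 -lt0n.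
    rewrite /mixture_pdf /uniform_vertex_law /uniform_law/=.
    rewrite (big_pred1 tt) => [|[]//]; rewrite card_unit invr1 mul1r.
    rewrite -(pair_bigA _ (fun o v => codebook_law k0 e01' o * #|V|%:R^-1 *
      gaussian_pdf s (pt (omap (fun=> v) o)) y))/= big_option/=.
    congr (_ + _).
      transitivity (\sum_(v : V) #|V|%:R^-1 * ((1 - e) * gaussian_pdf s (vertex R v0) y)).
        by apply: eq_bigr => v _; rewrite mulrA [_^-1 * _]mulrC.
      by rewrite -mulr_suml (uniform_law_sum1 R v0) mul1r.
    rewrite sumr_const card_ord -[LHS]mulr_natr -!mulr_sumr -/V.
    rewrite [LHS](_ : _ = e * (#|V|%:R^-1 * \sum_(v : V) gaussian_pdf s (vertex R v) y))//.
    rewrite /pt/=; move: (\sum_v _) => S.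
    by field; rewrite cardV kR.
  have := mixture_entropy_concave s0 e01' pdfU.
  apply: le_trans; rewrite /b.
  have := uniform_vertex_entropy_ge d s0.
  have -> : mixture_entropy s (uniform_law R tt) (fun=> vertex R v0) = gaussian_entropy d s.
    rewrite -[RHS]opprK -(Rintegral_gaussian_xlnx s0 (vertex R v0)); congr (- _).
    apply: eq_Rintegral => y _; rewrite /mixture_pdf (big_pred1 tt) => [|[]//].
    by rewrite /= card_unit invr1 mul1r.
  move=> /(ler_wpM2l (ltW e0)); clear; lra.
have riskA c : \sum_(j : {ffun 'I_n -> option 'I_k})
    \prod_l w (j l) * `|A c - H (codebook_sample c j)| <= 2 * eta.
  apply: le_trans (hrisk _ w (x c) (fun o => cubes _)).
  rewrite le_eqVlt; apply/orP; left; apply/eqP/eq_bigr => j _.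
  congr (_ * `|_ - h _|); apply: eq_from_tnth => l.
  by rewrite !tnth_mktuple ffunE.
have riskB : \sum_(j : {ffun 'I_n -> option 'I_k}) \sum_(u : {ffun 'I_n -> V})
    \prod_l w (j l) * #|{ffun 'I_n -> V}|%:R^-1 * `|B - H (fresh_sample u j)| <= 2 * eta.
  rewrite -(sum_fresh_law k0 e01' v0 (fun o => `|B - H o|)).
  apply: le_trans (hrisk _ wU xU (fun o => cubes _)).
  rewrite le_eqVlt; apply/orP; left; apply/eqP/eq_bigr => z _.
  congr (_ * `|_ - h _|); apply: eq_from_tnth => l.
  by rewrite !tnth_mktuple ffunE.
have wE m : w (Some m) = e / k%:R by [].
have := birthday_risk v0 k0 wE ab bB Aa riskA riskB.
have kR : 0 < k%:R :> R by rewrite ltr0n.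
have : 1 / 2 <= 1 - (n%:R * e) ^+ 2 / k%:R.
  have : (n%:R * e) ^+ 2 / k%:R <= 1 / 2 by rewrite ler_pdivrMr//; clear -small; lra.
  by clear; lra.
have : 0 <= b - a by rewrite subr_ge0.
move: (b - a) ba => g; move: (1 - _) (e * _) => r t; clear; nra.
Qed.

End birthday_bound.

(** * Sample complexity *)

Section exponential_bound.
Context (R : realType).

(** For e = 33 eta / (d J) the conclusion of birthday_gap_bound fails, which forces
    (n e)^2 > k / 2, where k is the integer part of exp (d J / 4). *)
Lemma birthday_bound (n d : nat) (s eta : R) : s != 0 ->
  0 < eta < 4 / 33 ->
  (minimax_risk n s (supported_in_cube R d) <= eta%:E)%E ->
  4 <= d%:R * info_gain s ->
  - ln (33 * eta / (d%:R * info_gain s)) <= d%:R * info_gain s / 4 ->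
  expR (d%:R * info_gain s / 8) <= 20 * eta * n%:R.
Proof.
move=> s0 /andP[eta0 eta1] risk; set t := d%:R * info_gain s => t4 lne.
have t0 : 0 < t by exact: lt_le_trans t4.
pose X := expR (t / 8); pose e := 33 * eta / t.
have et : e * t = 33 * eta by rewrite /e divfK// gt_eqF.
have e0 : 0 < e by rewrite divr_gt0// mulr_gt0.
have e01 : 0 < e < 1.
  by rewrite e0/= ltr_pdivrMr// mul1r; apply: lt_le_trans t4; clear -eta1; lra.
have X1 : 1 <= X by rewrite -[leLHS]expR0 ler_expR divr_ge0// ltW.
have X2 : expR (t / 4) = X ^+ 2.
  by rewrite -expRM_natl; congr expR; field.
pose k := Num.truncn (X ^+ 2).
have /andP[kX Xk] : k%:R <= X ^+ 2 < k.+1%:R by apply: truncn_itv; exact: sqr_ge0.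
have k0 : (0 < k)%N.
  rewrite -ltnS -(ltr_nat R); apply: le_lt_trans Xk.
  by rewrite exprn_ege1.
have kR : 1 <= k%:R :> R by rewrite ler1n.
have lnk : ln k%:R <= t / 4.
  by rewrite -[leRHS]expRK X2 ler_ln ?posrE ?exprn_gt0 ?expR_gt0 ?ltr0n.
have large : k%:R / 2 < (n%:R * e) ^+ 2.
  rewrite ltNge; apply/negP => small.
  have := birthday_gap_bound s0 eta0 risk k0 e01 t4 lne lnk small.
  by rewrite -/t et; clear -eta0; lra.
rewrite -/X leNgt; apply/negP => nX.
have : n%:R * e * t < 33 / 20 * X.
  rewrite -mulrA et; clear -nX; lra.
have ne0 : 0 <= n%:R * e by rewrite mulr_ge0// ltW.
move: large; rewrite -natr1 in Xk.
move: (n%:R * e) ne0 => z z0 large zt.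
have z4 : z * 4 <= z * t by rewrite ler_wpM2l.
have zX : 40 * z <= 17 * X by clear -z4 zt z0 X1; lra.
clear -large Xk kR zX z0 X1; nra.
Qed.

End exponential_bound.

Theorem theorem1 (R : realType) :
  (exists gamma : R -> R,
     (forall s t : R, 0 < s -> s < t -> gamma t < gamma s) /\
     forall s : R, 0 < s ->
       0 < gamma s /\
       exists (d0 : nat) (eta0 c : R),
         [/\ (0 < d0)%N, 0 < eta0, 0 < c &
           forall (d : nat) (eta : R), (d0 <= d)%N -> 0 < eta < eta0 ->
             ((c * (2 `^ (gamma s * d%:R) / (eta * d%:R)))%:E <=
              sample_complexity eta s (supported_in_cube R d))%E])
  /\
  (exists2 c : R, 0 < c &
     forall d : nat, (0 < d)%N ->
       exists s0 eta0 : R,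
         [/\ 0 < s0, 0 < eta0 &
           forall s eta : R, 0 < s < s0 -> 0 < eta < eta0 ->
             ((c * (2 ^+ d / (eta * d%:R)))%:E <=
              sample_complexity eta s (supported_in_cube R d))%E]).
Proof.
have ln2 : 0 < ln 2 :> R by rewrite ln_gt0// ltr1n.
split; last first.
  (* The second part: for s < 1 the information gain is at least its value at 1,
     and eta < d / 2^d turns 1 / eta^2 into 2^d / (eta d). *)
  pose J : R := info_gain 1; have J0 : 0 < J by exact: info_gain_gt0.
  exists (ln 2 * J ^+ 4 / 2592).
    by rewrite divr_gt0 ?ltr0n// mulr_gt0// exprn_gt0.
  move=> d d0; have dR : 0 < d%:R :> R by rewrite ltr0n.
  have e0 : 0 < d%:R / 2 ^+ d :> R by rewrite divr_gt0// exprn_gt0.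
  exists 1, (Num.min (J / 36) (d%:R / 2 ^+ d)); split => //.
    by rewrite lt_min e0 divr_gt0.
  move=> s eta /andP[s0 s1] /andP[eta0]; rewrite lt_min => /andP[etaJ etad].
  apply: le_ereal_inf_tmp => _ [n [n0 risk] <-]; rewrite lee_fin.
  have Js : J < info_gain s by exact: info_gain_decreasing.
  have etaJs : eta <= info_gain s / 36.
    by apply: ltW; apply: lt_trans etaJ _; rewrite ltr_pM2r ?invr_gt0.
  have := two_point_bound (lt0r_neq0 s0) d0 eta0 etaJs risk.
  have J4 : J ^+ 4 <= info_gain s ^+ 4.
    by rewrite lerXn2r ?nnegrE ?ltW//; exact: lt_trans Js.
  move=> /(le_trans (ler_wpM2l (ltW ln2) J4)) nJ.
  have d2 : 2 ^+ d / (eta * d%:R) <= eta^-1 ^+ 2.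
    rewrite invfM mulrCA expr2 ler_pM2l ?invr_gt0//.
    by rewrite -invf_div lef_pV2 ?posrE// ltW.
  have c0 : 0 <= ln 2 * J ^+ 4 / 2592.
    by rewrite divr_ge0 ?ler0n// mulr_ge0 ?exprn_ge0// ltW.
  apply: le_trans (ler_wpM2l c0 d2) _.
  rewrite exprVn ler_pdivrMr ?exprn_gt0// ler_pdivrMr ?ltr0n//.
  by rewrite (_ : _ * 2592 = 2592 * eta ^+ 2 * n%:R)//; ring.
exists (fun s => info_gain s / 8); split.
  by move=> s t s0 st; rewrite ltr_pM2r ?invr_gt0// info_gain_decreasing.
move=> s s_gt0; have s0 := lt0r_neq0 s_gt0.
have J0 := info_gain_gt0 s0; have J1 := info_gain_le s.
split; first by rewrite divr_gt0.
set J := info_gain s in J0 J1 *.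
(* d >= 4 / J makes the entropy gap of the codebook test linear in d. *)
exists (Num.bound (4 / J)).+1, (J / 36), (Num.min (1 / 20) (ln 2 * J ^+ 3 / 100)).
split => //.
- by rewrite divr_gt0.
- by rewrite lt_min !divr_gt0 ?ltr0n// mulr_gt0// exprn_gt0.
move=> d eta dJ /andP[eta0 etaJ].
apply: le_ereal_inf_tmp => _ [n [n0 risk] <-]; rewrite lee_fin.
have d0 : (0 < d)%N by exact: leq_trans dJ.
have d1 : 1 <= d%:R :> R by rewrite ler1n.
have t4 : 4 <= d%:R * J.
  rewrite -ler_pdivrMr//; apply: le_trans (_ : (Num.bound (4 / J))%:R <= _).
    by apply/ltW/archi_boundP; rewrite divr_ge0// ltW.
  by rewrite ler_nat ltnW.
pose X := expR (d%:R * J / 8).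
have X1 : 1 <= X by rewrite -[leLHS]expR0 ler_expR divr_ge0// (le_trans _ t4).
have powX : 2 `^ (J / 8 * d%:R) <= X.
  rewrite /powR gt_eqF// ler_expR (_ : d%:R * J / 8 = J / 8 * d%:R); last by field.
  have ln2_le1 : ln 2 <= 1 :> R.
    have /ln_le_subr1 : 0 < 2 :> R by [].
    by move=> /le_trans; apply; clear; lra.
  by rewrite ler_piMr// mulr_ge0// divr_ge0// ltW.
set c := Num.min _ _.
have c0 : 0 <= c.
  by rewrite le_min !divr_ge0 ?ler0n// mulr_ge0 ?exprn_ge0// ltW.
have etad0 : 0 < eta * d%:R by rewrite mulr_gt0// ltr0n.
apply: (@le_trans _ _ (c * (X / (eta * d%:R)))).
  by rewrite ler_wpM2l// ler_wpM2r ?invr_ge0// ltW.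
rewrite mulrA ler_pdivrMr//.
have [lne|lne] := lerP (- ln (33 * eta / (d%:R * J))) (d%:R * J / 4).
  have etab : 0 < eta < 4 / 33 by rewrite eta0/=; clear -etaJ J1; lra.
  have := birthday_bound s0 etab risk t4 lne; rewrite -/J -/X => nX.
  have cX : c * X <= 1 / 20 * X by rewrite ler_wpM2r ?ge_min ?lexx// ltW// expR_gt0.
  have : eta * n%:R * 1 <= eta * n%:R * d%:R by rewrite ler_wpM2l// mulr_ge0// ltW.
  clear -cX nX; lra.
(* Here eta is exponentially small in d, so that 1 / eta^2 dominates. *)
have := two_point_bound s0 d0 eta0 (ltW etaJ) risk; rewrite -/J => nJ.
have t0 : 0 < d%:R * J by exact: lt_le_trans t4.
have etaX : 33 * eta * X <= d%:R * J.
  have : 33 * eta / (d%:R * J) * X <= 1.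
    rewrite -ler_pdivlMr ?expR_gt0// mul1r -expRN.
    have e0 : 0 < 33 * eta / (d%:R * J) by rewrite divr_gt0// mulr_gt0.
    rewrite -[leLHS](lnK e0) ler_expR.
    move: (d%:R * J) (ln _) lne t0 => t l; clear; lra.
  by rewrite mulrAC ler_pdivrMr// mul1r.
have cX : c * X <= ln 2 * J ^+ 3 / 100 * X.
  by rewrite ler_wpM2r ?ge_min ?lexx ?orbT// ltW// expR_gt0.
apply: le_trans cX _; rewrite -(ler_pM2r J0).
have X0 : 0 <= X by exact: expR_ge0.
have := ler_wpM2r X0 nJ.
have : eta * n%:R * (33 * eta * X) <= eta * n%:R * (d%:R * J).
  by rewrite ler_wpM2l// mulr_ge0// ltW.
have etan : 0 <= eta * n%:R * (d%:R * J).
  by apply: mulr_ge0; apply: mulr_ge0; rewrite ?ler0n// ltW.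
rewrite (_ : ln 2 * J ^+ 4 = ln 2 * J ^+ 3 * J); last by ring.
move: (ln 2 * J ^+ 3) (n%:R : R) (d%:R : R) etan => A N D.
clear; lra.
Qed.
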